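(* Let $f:\mathbb{R}^n_{++}\to\mathbb{R}$ be a symmetric function and let $A\in\mathbb{P}(2n)$. The function $f\circ d:\mathbb{P}(2n)\to\mathbb{R}$ is Fréchet differentiable at $A$ if and only if $f$ is Fréchet differentiable at $d(A)$. In this case, the gradient is given by $$\nabla(f\circ d)(A)=\tfrac12\, M\, D_{\nabla f(d(A))}\, M^\top$$ for any choice of $M\in\mathrm{SP}^\uparrow(2n,A)$.
   Context: $n$ is a positive integer and $\mathbb{R}^n_{++}$ is the set of vectors in $\mathbb{R}^n$ with strictly positive entries. $\mathbb{S}(2n)$ is the space of real symmetric $2n\times 2n$ matrices with inner product $\langle A,B\rangle=\operatorname{Tr}(A^\top B)$ and the induced (Frobenius) norm; $\mathbb{P}(2n)\subset\mathbb{S}(2n)$ is the open subset of positive definite matrices. Gradients of real functions on $\mathbb{P}(2n)$ are elements of $\mathbb{S}(2n)$, representing the derivative via this inner product. For $x\in\mathbb{R}^n$, $D_x:=\operatorname{Diag}(x)\oplus\operatorname{Diag}(x)$ (a $2n\times2n$ diagonal matrix). A real $2n\times 2n$ matrix $M$ is symplectic if $M^\top JM=J$ with $J=\begin{pmatrix}0&I_n\\-I_n&0\end{pmatrix}$. By Williamson's theorem, for each $A\in\mathbb{P}(2n)$ there is a unique vector $d(A)=(d_1(A),\dots,d_n(A))\in\mathbb{R}^n_{++}$ with $d_1(A)\le\cdots\le d_n(A)$ such that $M^\top AM=D_{d(A)}$ for some symplectic $M$ (the symplectic eigenvalues of $A$). $\mathrm{SP}^\uparrow(2n,A)$ denotes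 the set of all symplectic $M$ with $M^\top AM=D_{d(A)}$. A function $f:\mathbb{R}^n_{++}\to\mathbb{R}$ is symmetric if $f(Px)=f(x)$ for all $x\in\mathbb{R}^n_{++}$ and all $n\times n$ permutation matrices $P$. *)

(* Defs.v *)
From HB Require Import structures.
From mathcomp Require Import all_boot all_order all_algebra.
From mathcomp Require Import sesquilinear ring.
From mathcomp Require Import all_classical all_reals all_analysis.
Import Order.TTheory GRing.Theory Num.Theory.
Import numFieldNormedType.Exports.

Set Implicit Arguments.
Unset Strict Implicit.
Unset Printing Implicit Defensive.

Local Open Scope classical_set_scope.
Local Open Scope ring_scope.

(* On row vectors this is the standard inner product of R^n. *)
Definition mxdot (R : realType) (m n : nat) (A B : 'M[R]_(m, n)) : R :=
  \tr (A^T *m B).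

Section MxdotTheory.
Context {R : realType} {m n : nat}.
Implicit Types A B C : 'M[R]_(m, n).

Lemma mxdotE A B : mxdot A B = \sum_i \sum_j A i j * B i j.
Proof.
rewrite exchange_big; apply: eq_bigr => j _.
by rewrite mxE; apply: eq_bigr => i _; rewrite mxE.
Qed.

Lemma mxdotC A B : mxdot A B = mxdot B A.
Proof. by rewrite /mxdot -mxtrace_tr trmx_mul trmxK. Qed.

Lemma mxdotDr A B C : mxdot A (B + C) = mxdot A B + mxdot A C.
Proof. by rewrite /mxdot mulmxDr mxtraceD. Qed.

Lemma mxdotZr a A B : mxdot A (a *: B) = a * mxdot A B.
Proof. by rewrite /mxdot -scalemxAr mxtraceZ. Qed.

Lemma mxdotDl A B C : mxdot (A + B) C = mxdot A C + mxdot B C.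
Proof. by rewrite mxdotC mxdotDr !(mxdotC C). Qed.

Lemma mxdotZl a A B : mxdot (a *: A) B = a * mxdot A B.
Proof. by rewrite mxdotC mxdotZr mxdotC. Qed.

Lemma mxdot_ge0 A : 0 <= mxdot A A.
Proof.
by rewrite mxdotE; do 2![apply: sumr_ge0 => ? _]; rewrite -expr2 sqr_ge0.
Qed.

Lemma mxdot_eq0 A : mxdot A A = 0 -> A = 0.
Proof.
have sq_ge0 i j : 0 <= A i j * A i j by rewrite -expr2 sqr_ge0.
rewrite mxdotE => /psumr_eq0P A0; apply/matrixP => i j; rewrite mxE.
have /psumr_eq0P Ai0 := A0 (fun i _ => sumr_ge0 _ (fun j _ => sq_ge0 i j)) i isT.
by have /eqP := Ai0 (fun j _ => sq_ge0 i j) j isT; rewrite mulf_eq0 orbb => /eqP.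
Qed.

Lemma mxdot_CauchySchwarz A B : mxdot A B ^+ 2 <= mxdot A A * mxdot B B.
Proof.
have [B0|B_neq0] := eqVneq (mxdot B B) 0.
  have -> : B = 0 by exact: mxdot_eq0.
  by rewrite /mxdot mulmx0 linear0 expr2 mul0r mulr_ge0// mxdot_ge0.
have B_gt0 : 0 < mxdot B B by rewrite lt_neqAle eq_sym B_neq0 mxdot_ge0.
have := mxdot_ge0 (mxdot B B *: A + (- mxdot A B) *: B).
rewrite !(mxdotDl, mxdotDr, mxdotZl, mxdotZr) (mxdotC B A).
set a := mxdot A A; set b := mxdot B B; set c := mxdot A B => ge0.
rewrite -(ler_pM2l B_gt0) -subr_ge0 -/b; apply: le_trans ge0 _.
by rewrite le_eqVlt; apply/orP; left; apply/eqP; rewrite expr2; ring.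
Qed.

End MxdotTheory.

Section FrobeniusNorm.
Context {R : realType} {m n : nat}.
Implicit Types A B : 'M[R]_(m, n).

Definition frobenius A : R := Num.sqrt (mxdot A A).

Lemma frobeniusD A B : frobenius (A + B) <= frobenius A + frobenius B.
Proof.
rewrite -(@ler_pXn2r _ 2)// ?nnegrE ?addr_ge0 ?sqrtr_ge0// sqrrD.
rewrite !sqr_sqrtr ?mxdot_ge0// mxdotDl !mxdotDr (mxdotC B A).
rewrite addrA lerD2r -addrA lerD2l -mulr2n lerMn2r /=.
rewrite -sqrtrM ?mxdot_ge0//; apply: le_trans (ler_norm _) _.
by rewrite -sqrtr_sqr ler_wsqrtr// mxdot_CauchySchwarz.
Qed.

Lemma frobeniusZ a A : frobenius (a *: A) = `|a| * frobenius A.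
Proof.
by rewrite /frobenius mxdotZl mxdotZr mulrA -expr2 sqrtrM ?sqr_ge0// sqrtr_sqr.
Qed.

Lemma frobenius_eq0 A : frobenius A = 0 -> A = 0.
Proof.
move=> /eqP; rewrite sqrtr_eq0 => A_le0; apply: mxdot_eq0.
by apply/eqP; rewrite eq_le A_le0 mxdot_ge0.
Qed.

End FrobeniusNorm.

Definition symmx_pred (R : realType) (m : nat) : {pred 'M[R]_m} :=
  fun A => A \is symmetricmx.
Arguments symmx_pred : clear implicits.

(* The space of symmetric matrices, normed by the Frobenius norm (the library's
   norm on 'M[R]_m is the sup norm). *)
Record symmx (R : realType) (m : nat) := SymMx {
  mx_of_sym :> 'M[R]_m;
  _ : mx_of_sym \in symmx_pred R m
}.

Section SymMxStructure.
Context {R : realType} {m : nat}.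

Lemma symmx_predE (A : 'M[R]_m) : (A \in symmx_pred R m) = (A == A^T).
Proof.
by rewrite [LHS](_ : _ = (A \is symmetricmx))// is_hermitianmxE expr0 scale1r
  map_mx_id.
Qed.

Fact symmx_submod_closed : submod_closed (symmx_pred R m).
Proof.
split=> [|a A B]; first by rewrite symmx_predE trmx0.
by rewrite !symmx_predE linearP /= => /eqP <- /eqP <-.
Qed.

HB.instance Definition _ :=
  GRing.isSubmodClosed.Build R 'M[R]_m (symmx_pred R m) symmx_submod_closed.

HB.instance Definition _ := [isSub for @mx_of_sym R m].
HB.instance Definition _ := [Choice of symmx R m by <:].
HB.instance Definition _ := [SubChoice_isSubLmodule of symmx R m by <:].

Let norm (A : symmx R m) : R := frobenius A.

Fact symmx_normD (A B : symmx R m) : norm (A + B) <= norm A + norm B.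
Proof. exact: frobeniusD. Qed.

Fact symmx_normZ (a : R) (A : symmx R m) : norm (a *: A) = `|a| * norm A.
Proof. exact: frobeniusZ. Qed.

Fact symmx_norm_eq0 (A : symmx R m) : norm A = 0 -> A = 0.
Proof. by move=> /frobenius_eq0 A0; apply: val_inj. Qed.

HB.instance Definition _ := Lmodule_isNormed.Build R (symmx R m)
  symmx_normD symmx_normZ symmx_norm_eq0.

End SymMxStructure.

Definition posdef (R : realType) (m : nat) : set (symmx R m) :=
  [set A | forall v : 'cV[R]_m, v != 0 -> 0 < (v^T *m A *m v) 0 0].

Definition posvec (R : realType) (n : nat) : set 'rV[R]_n :=
  [set x | forall i, 0 < x 0 i].

Definition symmetric_fun (R : realType) (n : nat) (f : 'rV[R]_n -> R) : Prop :=
  forall (x : 'rV[R]_n) (P : 'M[R]_n),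
    posvec x -> is_perm_mx P -> f (x *m P) = f x.

Section Symplectic.
Context {R : realType} {n : nat}.

Definition Jmx : 'M[R]_(n + n) := block_mx 0 1%:M (- 1%:M) 0.

Definition symplectic (M : 'M[R]_(n + n)) : Prop := M^T *m Jmx *m M = Jmx.

Definition Dmx (x : 'rV[R]_n) : 'M[R]_(n + n) :=
  block_mx (diag_mx x) 0 0 (diag_mx x).

Definition is_sympl_eigs (A : 'M[R]_(n + n)) (x : 'rV[R]_n) : Prop :=
  [/\ posvec x,
      forall i j : 'I_n, (i <= j)%N -> x 0 i <= x 0 j
    & exists2 M, symplectic M & M^T *m A *m M = Dmx x].

(* On positive definite A there is exactly one such vector, by Williamson's
   theorem. *)
Definition sympl_eigs (A : symmx R (n + n)) : 'rV[R]_n :=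
  xget 0 [set x | is_sympl_eigs A x].

Definition SPup (A : symmx R (n + n)) : set 'M[R]_(n + n) :=
  [set M | symplectic M /\ M^T *m A *m M = Dmx (sympl_eigs A)].

End Symplectic.

(* The vector representing the derivative of F at x via the inner product ip. *)
Definition gradient (R : realType) (V : normedModType R) (ip : V -> V -> R)
    (F : V -> R) (x : V) : V :=
  xget 0 [set g | forall h, 'd F x h = ip g h].

Definition grad_vec (R : realType) (n : nat) (f : 'rV[R]_n -> R) :
  'rV[R]_n -> 'rV[R]_n := gradient (@mxdot R 1 n) f.

Definition grad_sym (R : realType) (m : nat) (F : symmx R m -> R) :
  symmx R m -> symmx R m := gradient (fun A B : symmx R m => mxdot A B) F.

(* Main.v *)
Require Import Defs.
From HB Require Import structures.
From mathcomp Require Import all_boot all_order all_algebra.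
From mathcomp Require Import ring lra perm.
From mathcomp Require Import all_classical all_reals all_analysis.
Import Order.TTheory GRing.Theory Num.Theory.
Import numFieldNormedType.Exports.

Set Implicit Arguments.
Unset Strict Implicit.
Unset Printing Implicit Defensive.

Local Open Scope classical_set_scope.
Local Open Scope ring_scope.

(* If [N] is symplectic and [N^T B N = D_y] then [-(J B)^2 = N D_y^2 N^-1], so
   [\tr p(-(J B)^2) = 2 \sum_i p(y_i^2)] for every polynomial [p].  Hence
   polynomial symmetric functions of the symplectic eigenvalues are polynomial
   in the matrix.  Conjugating by [M], take [A = D_x] with perturbation [H]:
   by Gershgorin each [y_i] is [O(H)]-close to some [x_j], and traces of
   interpolating polynomials count how many fall near each [x_j], so a
   permutation of [y] is [O(H)]-close to [x].  By symmetry of [f] its gradient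
   [g] at [x] is constant on the blocks of equal [x_i], so some [p] has
   [p'(x_i^2) = g_i / (2 x_i)] for all [i]; then [\sum_i p(y_i^2)] has the same
   first-order expansion as [\sum_i g_i y_i], and its derivative in [H] is read
   off the trace.  Conversely, [f] coincides near [d(A)] with [f o d] composed
   with the linear map [x |-> M^-T D_x M^-1]. *)

(** * Cauchy-Schwarz bounds for the Frobenius norm *)

Section FrobeniusAlgebra.
Context {R : realType}.

Lemma frobenius_ge0 m n (A : 'M[R]_(m, n)) : 0 <= frobenius A.
Proof. exact: sqrtr_ge0. Qed.

Lemma sqr_frobenius m n (A : 'M[R]_(m, n)) : frobenius A ^+ 2 = mxdot A A.
Proof. by rewrite sqr_sqrtr ?mxdot_ge0. Qed.

Lemma frobenius0 m n : frobenius (0 : 'M[R]_(m, n)) = 0.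
Proof. by rewrite /frobenius /mxdot mulmx0 mxtrace0 sqrtr0. Qed.

Lemma frobeniusN m n (A : 'M[R]_(m, n)) : frobenius (- A) = frobenius A.
Proof. by rewrite -scaleN1r frobeniusZ normrN1 mul1r. Qed.

Lemma frobenius_tr m n (A : 'M[R]_(m, n)) : frobenius A^T = frobenius A.
Proof. by rewrite /frobenius /mxdot trmxK mxtrace_mulC. Qed.

Lemma mxdot_le_frobenius m n (A B : 'M[R]_(m, n)) :
  `|mxdot A B| <= frobenius A * frobenius B.
Proof.
by rewrite -sqrtr_sqr -sqrtrM ?mxdot_ge0// ler_wsqrtr// mxdot_CauchySchwarz.
Qed.

Lemma mxtrace_mul_le_frobenius m n (A : 'M[R]_(m, n)) (B : 'M[R]_(n, m)) :
  `|\tr (A *m B)| <= frobenius A * frobenius B.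
Proof. by rewrite -(frobenius_tr A) -[in leLHS](trmxK A) mxdot_le_frobenius. Qed.

Lemma entry_le_frobenius m n (A : 'M[R]_(m, n)) i j : `|A i j| <= frobenius A.
Proof.
rewrite -sqrtr_sqr ler_wsqrtr// mxdotE (bigD1 i)//= (bigD1 j)//= expr2 -addrA.
rewrite lerDl addr_ge0//; first by apply: sumr_ge0 => *; rewrite -expr2 sqr_ge0.
by do 2!apply: sumr_ge0 => *; rewrite -expr2 sqr_ge0.
Qed.

(** Each entry of the product pairs a row of [A] with a column of [B]; Cauchy-Schwarz bounds its
    square, and the sum of these bounds factors. *)
Lemma frobeniusM m n p (A : 'M[R]_(m, n)) (B : 'M[R]_(n, p)) :
  frobenius (A *m B) <= frobenius A * frobenius B.
Proof.
rewrite -sqrtrM ?mxdot_ge0// ler_wsqrtr// !mxdotE mulr_suml ler_sum// => i _.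
rewrite [X in _ * X]exchange_big mulr_sumr ler_sum// => j _.
have -> : (A *m B) i j = mxdot (row i A)^T (col j B).
  by rewrite mxE mxdotE; apply: eq_bigr => k _; rewrite big_ord1 !mxE.
have -> : \sum_k A i k * A i k = mxdot (row i A)^T (row i A)^T.
  by rewrite mxdotE; apply: eq_bigr => k _; rewrite big_ord1 !mxE.
have -> : \sum_k B k j * B k j = mxdot (col j B) (col j B).
  by rewrite mxdotE; apply: eq_bigr => k _; rewrite big_ord1 !mxE.
by rewrite -expr2 mxdot_CauchySchwarz.
Qed.

End FrobeniusAlgebra.

(** * First-order perturbation of matrix polynomials *)

Section HornerPerturbation.
Context {R : realType} {m : nat}.
Implicit Types (X E Y : 'M[R]_m.+1) (p : {poly R}).

Lemma horner_mx_bounded p (b : R) : 0 <= b ->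
  exists2 C, 0 <= C &
    forall X, frobenius X <= b -> frobenius (horner_mx X p) <= C.
Proof.
move=> b_ge0; elim/poly_ind: p => [|p c [C C0 IH]].
  by exists 0 => // X _; rewrite rmorph0 frobenius0.
exists (C * b + frobenius (c%:M : 'M[R]_m.+1)) => [|X Xb].
  by rewrite addr_ge0 ?mulr_ge0 ?frobenius_ge0.
rewrite rmorphD rmorphM /= horner_mx_X horner_mx_C.
apply: le_trans (frobeniusD _ _) _; rewrite lerD2r.
by apply: le_trans (frobeniusM _ _) _; rewrite ler_pM ?frobenius_ge0 ?IH.
Qed.

(** Induction through the telescoping [(P - Q) (X + E) + Q E]; the restriction on [E] keeps [X + E]
    in the ball of radius [b + 1], so the constant is uniform. *)
Lemma horner_mx_lipschitz p (b : R) : 0 <= b ->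
  exists2 C, 0 <= C & forall X E, frobenius X <= b -> frobenius E <= 1 ->
    frobenius (horner_mx (X + E) p - horner_mx X p) <= C * frobenius E.
Proof.
move=> b_ge0; elim/poly_ind: p => [|p c [C C0 IH]].
  exists 0 => // X E _ _.
  by rewrite !rmorph0 subr0 frobenius0 mul0r.
have [C' C'0 bd] := horner_mx_bounded p b_ge0.
exists (C * (b + 1) + C') => [|X E Xb E1].
  by rewrite addr_ge0// mulr_ge0// addr_ge0.
rewrite !rmorphD !rmorphM /= !horner_mx_X !horner_mx_C opprD addrACA subrr addr0.
set P := horner_mx (X + E) p; set Q := horner_mx X p.
have -> : P * (X + E) - Q * X = (P - Q) *m (X + E) + Q *m E.
  by rewrite mulmxBl [in X in _ - X + _]mulmxDr opprD -addrA -addrA addNr addr0.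
apply: le_trans (frobeniusD _ _) _; rewrite mulrDl lerD//.
  apply: le_trans (frobeniusM _ _) _; rewrite mulrAC ler_pM ?frobenius_ge0 ?IH//.
  by apply: le_trans (frobeniusD _ _) _; rewrite lerD.
by apply: le_trans (frobeniusM _ _) _; rewrite ler_wpM2r ?frobenius_ge0 ?bd.
Qed.

(* The weight [Y] is what makes the induction on [p] go through: cyclicity of
   the trace moves the factor [X] of [p * 'X] into [Y]. *)
Lemma mxtrace_horner_mx_taylor p (b : R) : 0 <= b ->
  exists2 C, 0 <= C & forall X E Y, comm_mx X Y ->
    frobenius X <= b -> frobenius E <= 1 ->
    `|\tr (Y *m horner_mx (X + E) p) - \tr (Y *m horner_mx X p)
      - \tr (Y *m horner_mx X p^`() *m E)| <= C * frobenius Y * frobenius E ^+ 2.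
Proof.
move=> b_ge0; elim/poly_ind: p => [|p c [C C0 IH]].
  exists 0 => // X E Y _ _ _.
  by rewrite deriv0 !rmorph0 mulmx0 mul0mx mxtrace0 !subr0 normr0 !mul0r.
have [L L0 lip] := horner_mx_lipschitz p b_ge0.
exists (C * b + L) => [|X E Y cXY Xb E1]; first by rewrite addr_ge0// mulr_ge0.
rewrite derivD derivC addr0 derivM derivX mulr1.
rewrite !rmorphD !rmorphM /= !horner_mx_X !horner_mx_C.
set P := horner_mx (X + E) p; set Q := horner_mx X p; set Q' := horner_mx X p^`().
have := IH X E (X *m Y).
rewrite -/P -/Q -/Q' => /(_ _ Xb E1) H1.
have {}H1 : `|\tr (X *m Y *m P) - \tr (X *m Y *m Q) - \tr (X *m Y *m Q' *m E)|
    <= C * (b * frobenius Y) * frobenius E ^+ 2.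
  apply: le_trans (H1 _) _; first by rewrite /comm_mx -mulmxA cXY.
  rewrite ler_wpM2r ?sqr_ge0// ler_wpM2l//.
  by apply: le_trans (frobeniusM _ _) _; rewrite ler_wpM2r ?frobenius_ge0.
(* The product rule leaves this cross term, of second order because [P - Q] is already Lipschitz in
   [E]. *)
have H2 : `|\tr (Y *m (P - Q) *m E)| <= L * frobenius Y * frobenius E ^+ 2.
  apply: le_trans (mxtrace_mul_le_frobenius _ _) _.
  rewrite expr2 mulrA ler_wpM2r ?frobenius_ge0//.
  apply: le_trans (frobeniusM _ _) _; rewrite mulrC mulrAC ler_wpM2r ?frobenius_ge0//.
  exact: lip.
have cXQ' : X *m Q' = Q' *m X by apply: comm_mx_horner.
rewrite [X in `|X|](_ : _ = (\tr (X *m Y *m P) - \tr (X *m Y *m Q)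
    - \tr (X *m Y *m Q' *m E)) + \tr (Y *m (P - Q) *m E)).
  apply: le_trans (ler_normD _ _) _.
  apply: le_trans (lerD H1 H2) _.
  by rewrite le_eqVlt; apply/orP; left; apply/eqP; ring.
rewrite -[P * _]/(P *m _) -[Q * _]/(Q *m _) -[Q' * _]/(Q' *m _).
rewrite -(mulmxA X Y P) -(mulmxA X Y Q) !(mxtrace_mulC X (Y *m _)).
rewrite !(mulmxDr, mulmxDl, mulmxBr, mulmxBl, mxtraceD, mulmxN, mulNmx, raddfN) /=.
rewrite -cXQ' !mulmxA -cXY; ring.
Qed.

End HornerPerturbation.

(** A new node [a] is added through [('X - a) q^2]: its derivative vanishes at the old nodes, which
    are double roots of [q^2], and equals [q(a)^2] at [a]. *)
Lemma exists_deriv_interp (F : fieldType) (s : seq F) (v : F -> F) :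
  exists p : {poly F}, forall a, a \in s -> p^`().[a] = v a.
Proof.
elim: s => [|a s [p pv]]; first by exists 0.
have [as_in|aNs] := boolP (a \in s).
  by exists p => b; rewrite inE => /predU1P[->|]; apply: pv.
pose q : {poly F} := \prod_(b <- s) ('X - b%:P).
have qa : q.[a] != 0.
  by rewrite -/(root q a) root_prod_XsubC.
exists (p + ((v a - p^`().[a]) / q.[a] ^+ 2) *: (('X - a%:P) * q ^+ 2)) => b.
rewrite derivD derivZ derivM derivXsubC mul1r deriv_exp.
rewrite !hornerE inE => /predU1P[->|bs].
  rewrite subrr mul0r addr0 mulfVK; last by rewrite expf_neq0.
  by rewrite addrC subrK.
have -> : q.[b] = 0 by apply/eqP; rewrite -/(root q b) root_prod_XsubC.
by rewrite expr0n !(mulr0, addr0) pv.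
Qed.

(** * Algebra of the doubled diagonal matrices *)

Section Dmx.
Context {R : realType} {n : nat}.
Implicit Types x y : 'rV[R]_n.

Lemma DmxE x : Dmx x = diag_mx (row_mx x x).
Proof. by rewrite diag_mx_row. Qed.

Lemma DmxD x y : Dmx (x + y) = Dmx x + Dmx y.
Proof. by rewrite /Dmx add_block_mx !addr0 !raddfD. Qed.

Lemma DmxZ a x : Dmx (a *: x) = a *: Dmx x.
Proof. by rewrite /Dmx scale_block_mx !scaler0 !linearZ. Qed.

Lemma DmxB x y : Dmx (x - y) = Dmx x - Dmx y.
Proof. by rewrite -scaleN1r DmxD DmxZ scaleN1r. Qed.

Lemma Dmx_mul x y : Dmx x *m Dmx y = Dmx (\row_i (x 0 i * y 0 i)).
Proof.
rewrite /Dmx mulmx_block !(mulmx0, mul0mx, addr0, add0r) mulmx_diag.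
by congr block_mx; congr diag_mx; apply/rowP => i; rewrite !mxE.
Qed.

Lemma tr_Dmx x : (Dmx x)^T = Dmx x.
Proof. by rewrite DmxE tr_diag_mx. Qed.

Lemma mxtrace_Dmx x : \tr (Dmx x) = 2 * \sum_i x 0 i.
Proof. by rewrite /Dmx mxtrace_block !mxtrace_diag mulr_natl mulr2n. Qed.

Lemma frobenius_Dmx_le x : frobenius (Dmx x) <= 2 * \sum_i `|x 0 i|.
Proof.
have s_ge0 : 0 <= \sum_i `|x 0 i| by apply: sumr_ge0.
rewrite -(@ler_pXn2r _ 2)// ?nnegrE ?mulr_ge0 ?frobenius_ge0//.
rewrite sqr_frobenius /mxdot tr_Dmx Dmx_mul mxtrace_Dmx.
have : \sum_i (\row_i (x 0 i * x 0 i) : 'rV_n) 0 i <= (\sum_i `|x 0 i|) ^+ 2.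
  rewrite expr2 mulr_suml ler_sum// => i _; rewrite mxE.
  rewrite -expr2 -[leLHS]real_normK ?num_real// expr2 ler_wpM2l// (bigD1 i)//= lerDl.
  exact: sumr_ge0.
by set S := \sum_i _ => h; have := sqr_ge0 (\sum_i `|x 0 i|); nra.
Qed.

End Dmx.

Lemma horner_mx_Dmx (R : realType) n (x : 'rV[R]_n.+1) p :
  horner_mx (Dmx x) p = Dmx (map_mx (horner p) x).
Proof. by rewrite !DmxE -map_row_mx; apply: horner_mx_diag. Qed.

Lemma mxtrace_horner_Dmx (R : realType) n (x : 'rV[R]_n.+1) p :
  \tr (horner_mx (Dmx x) p) = 2 * \sum_i p.[x 0 i].
Proof.
rewrite horner_mx_Dmx (mxtrace_Dmx (map_mx _ x)).
by congr (_ * _); apply: eq_bigr => i _; rewrite mxE.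
Qed.

(** Here [E v] has coordinates [(t - d_i) v_i]. If every [t - d_i] exceeded [frobenius E] in
    absolute value, [E v] would be longer than submultiplicativity allows, strictly so because some
    coordinate of [v] is nonzero. *)
Lemma gershgorin_diag (R : realType) m (d : 'rV[R]_m) (E : 'M[R]_m)
    (v : 'cV[R]_m) t :
  v != 0 -> (diag_mx d + E) *m v = t *: v ->
  exists i, `|t - d 0 i| <= frobenius E.
Proof.
move=> v0 dEv; apply: contrapT => /forallNP far.
have Ev : E *m v = \col_i ((t - d 0 i) * v i 0).
  apply/colP => i; rewrite mxE mulrBl.
  have /colP/(_ i) := dEv; rewrite mulmxDl mul_diag_mx !mxE => <-.
  by rewrite addrAC subrr add0r.
have : frobenius (E *m v) ^+ 2 <= (frobenius E * frobenius v) ^+ 2.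
  by rewrite ler_pXn2r ?nnegrE ?mulr_ge0 ?frobenius_ge0// frobeniusM.
apply/negP; rewrite -ltNge exprMn Ev !sqr_frobenius !mxdotE mulr_sumr.
have [k vk] : exists k, v k 0 != 0.
  apply: contrapT => /forallNP vk; move/negP: v0; apply; apply/eqP/colP => k.
  by rewrite mxE; apply/eqP/negPn/negP/vk.
have le_i i : mxdot E E * (v i 0) ^+ 2 <= ((t - d 0 i) * v i 0) ^+ 2.
  rewrite exprMn ler_wpM2r ?sqr_ge0// -sqr_frobenius -[leRHS]real_normK ?num_real//.
  by rewrite ler_pXn2r ?nnegrE ?frobenius_ge0// ltW// ltNge; apply/negP/far.
rewrite (bigD1 k)//= [ltRHS](bigD1 k)//= !big_ord1 ltr_leD//.
  rewrite !mxE -!expr2 exprMn ltr_pM2r ?exprn_even_gt0//.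
  rewrite -mxdotE -sqr_frobenius -[ltRHS]real_normK ?num_real//.
  by rewrite ltr_pXn2r ?nnegrE ?frobenius_ge0// ltNge; apply/negP/far.
by apply: ler_sum => i _; rewrite !big_ord1 !mxE -!expr2 -mxdotE.
Qed.

(** Equal fibre sizes make the two families equal as multisets, even though [sigma] may fail to be
    injective. *)
Lemma perm_of_card_fibers (T : eqType) n (t : 'I_n -> T) (sigma : 'I_n -> 'I_n) :
  (forall j, #|[pred i | t (sigma i) == t j]| = #|[pred i | t i == t j]|) ->
  exists tau : 'S_n, forall i, t (sigma (tau i)) = t i.
Proof.
move=> st.
have /tuple_permP[tau Htau] :
    perm_eq [tuple t i | i < n] [tuple t (sigma i) | i < n].
  have count_map (u : 'I_n -> T) j :
      count_mem (t j) [tuple u i | i < n] = #|[pred i | u i == t j]|.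
    by rewrite count_map -size_filter cardE /enum_mem -enumT.
  apply/allP => v; rewrite mem_cat => v_in.
  have [j ->] : exists j, v = t j.
    by case/orP: v_in => /mapP[i _ ->]; [exists i|exists (sigma i)].
  by rewrite /= !count_map st.
exists tau => i; move/(congr1 (fun s => nth (t i) s i)): Htau.
by rewrite -!tnth_nth !tnth_mktuple.
Qed.

(** * Eigenvalues of a perturbed diagonal matrix *)

Section DiagonalPerturbation.
Context {R : realType} {n : nat}.
Implicit Types d t w : 'rV[R]_n.+1.

Lemma row_sum_le m (u : 'rV[R]_m) (e : R) :
  (forall i, `|u 0 i| <= e) -> \sum_i `|u 0 i| <= m%:R * e.
Proof.
move=> ue; apply: le_trans (ler_sum _ (fun i _ => ue i)) _.
by rewrite sumr_const card_ord mulr_natl.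
Qed.

Lemma mxtrace_horner_conj (X N Y : 'M[R]_(n.+1 + n.+1)) p :
  N \in unitmx -> X *m N = N *m Y -> \tr (horner_mx X p) = \tr (horner_mx Y p).
Proof.
move=> N_unit XN.
have -> : X = N *m Y *m invmx N by rewrite -XN mulmxK.
by rewrite horner_mx_uconj// mxtrace_mulC mulKmx.
Qed.

(** Column [i] of [N] is an eigenvector for [t 0 i], nonzero since [N] is invertible, so the
    Gershgorin bound applies to it. *)
Lemma eigenvalue_near d t (E N : 'M[R]_(n.+1 + n.+1)) :
  N \in unitmx -> (Dmx d + E) *m N = N *m Dmx t ->
  forall i, exists j, `|t 0 i - d 0 j| <= frobenius E.
Proof.
move=> N_unit DEN i; pose v := col (lshift n.+1 i) N.
have v0 : v != 0.
  apply/eqP => v0; have := congr1 (col (lshift n.+1 i)) (mulVmx N_unit).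
  rewrite colE -mulmxA -colE -/v v0 mulmx0 => /colP/(_ (lshift n.+1 i)).
  by rewrite !mxE eqxx => /eqP; rewrite eq_sym oner_eq0.
have Ev : (diag_mx (row_mx d d) + E) *m v = t 0 i *: v.
  rewrite -DmxE /v colE mulmxA DEN -colE DmxE; apply/colP => k.
  by rewrite -colE mul_mx_diag mxE mxE row_mxEl !mxE mulrC.
have [j] := gershgorin_diag v0 Ev.
case: (split_ordP j) => k ->; rewrite ?row_mxEl ?row_mxEr => h; exists k; exact: h.
Qed.

(** Both [Dmx d + E] and [Dmx t'], with [t'] the reordered [t], give [p] the same trace. Expanding
    that trace around [Dmx d] in these two ways, with [p' = w] at the nodes, yields two first-order
    terms that differ by a second-order error. *)
Lemma perturb_Dmx d w :
  (forall i j, d 0 i = d 0 j -> w 0 i = w 0 j) ->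
  exists C delta : R, [/\ 0 <= C, 0 < delta &
    forall (t : 'rV[R]_n.+1) (E N : 'M[R]_(n.+1 + n.+1)), frobenius E <= delta ->
      N \in unitmx -> (Dmx d + E) *m N = N *m Dmx t ->
    exists tau : 'S_n.+1,
      (forall i, `|t 0 (tau i) - d 0 i| <= frobenius E) /\
      `|2 * \sum_i w 0 i * (t 0 (tau i) - d 0 i) - \tr (Dmx w *m E)|
        <= C * frobenius E ^+ 2].
Proof.
move=> wd; set K := n.+1.
pose I1 : R := frobenius (1%:M : 'M[R]_(K + K)).
have I1_ge0 : 0 <= I1 := frobenius_ge0 _.
pose ds (s : {ffun 'I_K -> 'I_K}) : 'rV[R]_K := \row_i d 0 (s i).
(* The base point [Dmx (ds s)] used below depends on the matching [s], hence on [E]; summing over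
   all [s] makes the constants independent of it. *)
pose b : R := \sum_s frobenius (Dmx (ds s)).
have b_ge0 : 0 <= b by apply: sumr_ge0 => s _; apply: frobenius_ge0.
have le_b s : frobenius (Dmx (ds s)) <= b.
  by rewrite /b (bigD1 s)//= lerDl sumr_ge0// => ? _; apply: frobenius_ge0.
have le_bd : frobenius (Dmx d) <= b.
  rewrite (_ : d = ds [ffun i => i]) ?le_b//.
  by apply/rowP => i; rewrite mxE ffunE.
(* The indicator of the value [d 0 j] on the nodes is obtained as the derivative of an interpolating
   polynomial. *)
have ind (j : 'I_K) : exists q : {poly R},
    forall i, q.[d 0 i] = (d 0 i == d 0 j)%:R.
  have [p Hp] := exists_deriv_interp [seq d 0 i | i : 'I_K]
    (fun a => (a == d 0 j)%:R).
  by exists p^`() => i; apply: Hp; apply: map_f; rewrite mem_enum.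
have /choice[q Hq] := ind.
have lipq (j : 'I_K) := horner_mx_lipschitz (m := n + K) (q j) b_ge0.
have /choice[L HL] : forall j, exists L, 0 <= L /\ forall X E : 'M[R]_(K + K),
    frobenius X <= b -> frobenius E <= 1 ->
    `|\tr (horner_mx (X + E) (q j)) - \tr (horner_mx X (q j))| <= L * frobenius E.
  move=> j; have [L L0 HL] := lipq j.
  exists (I1 * L); split => [|X E Xb E1]; first by rewrite mulr_ge0.
  rewrite -raddfB /= -[X in \tr X]mul1mx.
  apply: le_trans (mxtrace_mul_le_frobenius _ _) _; rewrite -mulrA.
  by rewrite ler_wpM2l//; apply: HL.
(* [u] is [w] as a function of the value of [d], well defined by [wd]; the default [ord0] is reached
   only off the range of [d]. *)
pose u (a : R) : R := w 0 (odflt ord0 [pick i | d 0 i == a]).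
have ud i : u (d 0 i) = w 0 i.
  rewrite /u; case: pickP => [j /eqP/wd|/(_ i)] //=; by rewrite eqxx.
have [p Hp] := exists_deriv_interp [seq d 0 i | i : 'I_K] u.
have {Hp}pw i : p^`().[d 0 i] = w 0 i.
  by rewrite Hp ?ud//; apply: map_f; rewrite mem_enum.
have [C C_ge0 HC] := mxtrace_horner_mx_taylor (m := n + K) p b_ge0.
pose Ls := \sum_j L j.
have Ls_ge0 : 0 <= Ls by apply: sumr_ge0 => j _; have [] := HL j.
have le_Ls j : L j <= Ls.
  by rewrite /Ls (bigD1 j)//= lerDl sumr_ge0// => k _; have [] := HL k.
(* [frobenius E * D <= 1] forces the three bounds [E1], [EK] and [EL] at once. *)
pose D : R := (2 * K%:R) + 1 + Ls * (2 * K%:R + 1).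
have D_gt0 : 0 < D by rewrite /D; have := ler0n R K; nra.
exists (C * I1 + C * I1 * (2 * K%:R) ^+ 2), D^-1; split.
- by rewrite addr_ge0// !mulr_ge0// sqr_ge0.
- by rewrite invr_gt0.
move=> t E N Esmall N_unit DEN.
have E_ge0 : 0 <= frobenius E := frobenius_ge0 _.
have ED : frobenius E * D <= 1 by rewrite -ler_pdivlMr// mul1r.
have K_ge0 : 0 <= K%:R :> R := ler0n R K.
have EK_ge0 : 0 <= frobenius E * K%:R by rewrite mulr_ge0.
have EL_ge0 : 0 <= frobenius E * Ls by rewrite mulr_ge0.
have EKL_ge0 : 0 <= frobenius E * K%:R * Ls by rewrite mulr_ge0.
have E1 : frobenius E <= 1 by move: ED; rewrite /D; lra.
have EK : frobenius E * (2 * K%:R) <= 1 by move: ED; rewrite /D; lra.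
have EL : Ls * ((2 * K%:R + 1) * frobenius E) <= 1 by move: ED; rewrite /D; lra.
have /choice[sigma Hsigma] := eigenvalue_near N_unit DEN.
have diag_le (x y : 'rV[R]_K) : (forall i, `|x 0 i - y 0 i| <= frobenius E) ->
    frobenius (Dmx x - Dmx y) <= 2 * K%:R * frobenius E.
  move=> xy; rewrite -DmxB; apply: le_trans (frobenius_Dmx_le _) _.
  rewrite -mulrA ler_wpM2l// row_sum_le// => i.
  by apply: le_trans (xy i); rewrite !mxE.
have tr_t q' : \tr (horner_mx (Dmx d + E) q') = 2 * \sum_i q'.[t 0 i].
  by rewrite (mxtrace_horner_conj q' N_unit DEN) mxtrace_horner_Dmx.
(* The trace of [q j] moves little from [Dmx d] to [Dmx d + E], and from [Dmx (ds s)] to [Dmx t].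
   Twice the difference of the two counts is therefore at most 1 in absolute value, so these
   integers agree. *)
have fibers j :
    #|[pred i | d 0 (sigma i) == d 0 j]| = #|[pred i | d 0 i == d 0 j]|.
  have [_ HLj] := HL j.
  have := HLj _ _ le_bd E1; rewrite tr_t mxtrace_horner_Dmx => h1.
  pose s := [ffun i => sigma i].
  have tE : frobenius (Dmx t - Dmx (ds s)) <= 2 * K%:R * frobenius E.
    by apply: diag_le => i; rewrite mxE ffunE.
  have tE1 : frobenius (Dmx t - Dmx (ds s)) <= 1.
    by apply: le_trans tE _; rewrite mulrC.
  have := HLj _ _ (le_b s) tE1.
  rewrite (addrC (Dmx (ds s))) subrK !mxtrace_horner_Dmx => h2.
  have card_sum (r : 'I_K -> 'I_K) :
      #|[pred i | d 0 (r i) == d 0 j]|%:R = \sum_i (q j).[d 0 (r i)] :> R.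
    rewrite -sum1_card natr_sum big_mkcond /=; apply: eq_bigr => i _.
    by rewrite Hq inE; case: eqP.
  have : `|#|[pred i | d 0 (sigma i) == d 0 j]|%:R
        - #|[pred i | d 0 i == d 0 j]|%:R| <= 2^-1 :> R.
    rewrite (card_sum sigma) (card_sum id).
    have sE : \sum_i (q j).[ds s 0 i] = \sum_i (q j).[d 0 (sigma i)].
      by apply: eq_bigr => i _; rewrite mxE ffunE.
    move: h1 h2; rewrite sE.
    have Lj_ge0 := (HL j).1; have Lj_le := le_Ls j.
    have LE1 : L j * frobenius (Dmx t - Dmx (ds s)) <=
        L j * (2 * K%:R * frobenius E).
      by rewrite ler_wpM2l.
    have LE2 : L j * ((2 * K%:R + 1) * frobenius E) <=
        Ls * ((2 * K%:R + 1) * frobenius E).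
      by rewrite ler_wpM2r// mulr_ge0// addr_ge0// mulr_ge0.
    move: LE1 LE2 EL; set e1 := L j * frobenius _;
    rewrite !ler_norml => ? ? ? /andP[? ?] /andP[? ?]; lra.
  set a := #|_|; set c := #|[pred i | d 0 i == _]|.
  case: (ltngtP a c) => // lt_card;
    rewrite ler_norml => /andP[lo hi]; exfalso; move: lt_card;
    rewrite -(ler_nat R) -addn1 natrD => ?; lra.
have [tau Htau] := perm_of_card_fibers fibers.
pose t' : 'rV[R]_K := \row_i t 0 (tau i).
have t'd i : `|t' 0 i - d 0 i| <= frobenius E.
  by rewrite mxE -(Htau i).
exists tau; split => [i|]; first by have := t'd i; rewrite mxE.
have tE := diag_le _ _ t'd.
have tE1 : frobenius (Dmx t' - Dmx d) <= 1 by apply: le_trans tE _; rewrite mulrC.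
have c1 : comm_mx (Dmx d) (1%:M : 'M[R]_(K + K)) by rewrite /comm_mx mulmx1 mul1mx.
(* The Taylor bound with weight 1, once for the perturbation [E] and once for [Dmx t' - Dmx d]. *)
have := HC _ _ _ c1 le_bd E1; have := HC _ _ _ c1 le_bd tE1.
rewrite !mul1mx (addrC (Dmx d) (Dmx t' - _)) subrK tr_t !mxtrace_horner_Dmx.
rewrite horner_mx_Dmx.
have -> : map_mx (horner p^`()) d = w by apply/rowP => i; rewrite mxE.
have -> : \sum_i p.[t' 0 i] = \sum_i p.[t 0 i].
  rewrite [RHS](reindex_inj (@perm_inj _ tau)) /=.
  by apply: eq_bigr => i _; rewrite mxE.
have -> : \tr (Dmx w *m (Dmx t' - Dmx d)) =
    2 * \sum_i w 0 i * (t 0 (tau i) - d 0 i).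
  rewrite -DmxB Dmx_mul mxtrace_Dmx; congr (_ * _).
  by apply: eq_bigr => i _; rewrite !mxE.
rewrite -/I1; set S := 2 * \sum_i p.[t 0 i]; set S0 := 2 * \sum_i p.[d 0 i].
set W := 2 * \sum_i w 0 i * _; set T := \tr _ => h1 h2.
have h1' : `|S - S0 - W| <= C * I1 * ((2 * K%:R) ^+ 2 * frobenius E ^+ 2).
  apply: le_trans h1 _; rewrite ler_wpM2l ?mulr_ge0// -exprMn ler_pXn2r//.
    by rewrite nnegrE frobenius_ge0.
  by rewrite nnegrE !mulr_ge0.
have -> : W - T = (S - S0 - T) - (S - S0 - W) by ring.
apply: le_trans (ler_normB _ _) _; apply: le_trans (lerD h2 h1') _.
rewrite [leRHS](_ : _ = C * I1 * frobenius E ^+ 2 +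
  C * I1 * ((2 * K%:R) ^+ 2 * frobenius E ^+ 2)) ?lexx//; ring.
Qed.
End DiagonalPerturbation.

(** * Symplectic matrices and conjugation of [J B] *)

Section SymplecticMatrices.
Context {R : realType} {n : nat}.
Implicit Types (M N B : 'M[R]_(n + n)) (x y : 'rV[R]_n).
Local Notation J := (@Jmx R n).

Lemma tr_Jmx : J^T = - J.
Proof.
rewrite /Jmx tr_block_mx opp_block_mx !trmx0 raddfN /= !trmx1.
by rewrite opprK !oppr0.
Qed.

Lemma mul_Jmx : J *m J = - 1%:M.
Proof.
rewrite /Jmx mulmx_block !(mulmx0, mul0mx, addr0, add0r) mulmx1 mul1mx.
by rewrite scalar_mx_block opp_block_mx !oppr0.
Qed.

Lemma Jmx_Dmx x : J *m Dmx x = Dmx x *m J.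
Proof.
rewrite /Jmx /Dmx !mulmx_block !(mulmx0, mul0mx, addr0, add0r).
by rewrite mulNmx mulmxN !mulmx1 !mul1mx.
Qed.

Lemma symplectic_mulVmx M : symplectic M -> - (J *m M^T *m J) *m M = 1%:M.
Proof. by move=> sM; rewrite mulNmx -!mulmxA (mulmxA M^T) sM mul_Jmx opprK. Qed.

Lemma symplectic_unit M : symplectic M -> M \in unitmx.
Proof. by move=> /symplectic_mulVmx/mulmx1_unit[]. Qed.

Lemma symplectic_invmx M : symplectic M -> invmx M = - (J *m M^T *m J).
Proof.
by move=> sM; rewrite -[RHS]mulmx1 -(mulmxV (symplectic_unit sM)) mulmxA
  symplectic_mulVmx// mul1mx.
Qed.

Lemma symplecticM M N : symplectic M -> symplectic N -> symplectic (M *m N).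
Proof.
rewrite /symplectic trmx_mul => sM sN.
by rewrite -!mulmxA (mulmxA J) (mulmxA M^T) (mulmxA M^T) sM mulmxA.
Qed.

Lemma symplecticV M : symplectic M -> symplectic (invmx M).
Proof.
move=> sM; rewrite /symplectic -[in LHS]sM !mulmxA -trmx_mul.
by rewrite mulmxV ?symplectic_unit// trmx1 mul1mx mulmxK ?symplectic_unit.
Qed.

(** The key identity is [M J M^T = J]: the left inverse [- J M^T J] of [M] is also a right
    inverse. *)
Lemma symplectic_diag_conj M B x : symplectic M -> M^T *m B *m M = Dmx x ->
  J *m B *m M = M *m (J *m Dmx x).
Proof.
move=> sM BM; rewrite -BM.
have MJMJ : M *m J *m M^T = J.
  have := mulmx1C (symplectic_mulVmx sM); rewrite mulmxN => /(congr1 (mulmx^~ J)).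
  by rewrite mul1mx mulNmx -!mulmxA mul_Jmx !mulmxN mulmx1 opprK.
by rewrite !mulmxA MJMJ.
Qed.

(* Symplectic congruence on [B] is conjugation on [J B], and [(J D)^2 = - D^2]. *)
Lemma symplectic_sqr_conj M B x : symplectic M -> M^T *m B *m M = Dmx x ->
  - (J *m B *m (J *m B)) *m M = M *m Dmx (\row_i (x 0 i ^+ 2)).
Proof.
move=> sM BM; have JBM := symplectic_diag_conj sM BM.
rewrite mulNmx -(mulmxA (J *m B)) JBM (mulmxA (J *m B)) JBM -!mulmxA.
rewrite (mulmxA (Dmx x)) -Jmx_Dmx !mulmxA -(mulmxA M J J) mul_Jmx.
rewrite mulmxN mulmx1 !mulNmx opprK -mulmxA Dmx_mul.
by congr (_ *m Dmx _); apply/rowP => i; rewrite !mxE expr2.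
Qed.

End SymplecticMatrices.

(** * First-order expansion of symplectic eigenvalues at a diagonal matrix *)

Section SymplecticPerturbation.
Context {R : realType} {n : nat}.
Local Notation J := (@Jmx R n.+1).

(** [perturb_Dmx] is applied to the squares [d = x^2], [t = y^2] with weight [w = g / (2 x)]. This
    weight undoes the squaring: [w (y^2 - x^2) = g (y - x) + w (y - x)^2], whose last term is of
    second order. *)
Lemma symplectic_perturbation (x g : 'rV[R]_n.+1) : posvec x ->
  (forall i j, x 0 i = x 0 j -> g 0 i = g 0 j) ->
  exists C delta : R, [/\ 0 <= C, 0 < delta &
    forall (y : 'rV[R]_n.+1) (H N : 'M[R]_(n.+1 + n.+1)), frobenius H <= delta ->
      posvec y -> symplectic N -> N^T *m (Dmx x + H) *m N = Dmx y ->
    exists tau : 'S_n.+1,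
      (forall i, `|y 0 (tau i) - x 0 i| <= C * frobenius H) /\
      `|\sum_i g 0 i * (y 0 (tau i) - x 0 i) - 2^-1 * \tr (Dmx g *m H)|
        <= C * frobenius H ^+ 2].
Proof.
move=> x0 gx.
pose d : 'rV[R]_n.+1 := \row_i x 0 i ^+ 2.
pose w : 'rV[R]_n.+1 := \row_i (g 0 i / (2 * x 0 i)).
have wd i j : d 0 i = d 0 j -> w 0 i = w 0 j.
  rewrite !mxE => /eqP; rewrite eqrXn2// ?ltW ?x0// => /eqP xij.
  by rewrite xij (gx _ _ xij).
have [C2 [delta [C2_ge0 delta_gt0 pert]]] := perturb_Dmx wd.
pose j := frobenius J; have j_ge0 : 0 <= j := frobenius_ge0 _.
pose fx := frobenius (Dmx x); have fx_ge0 : 0 <= fx := frobenius_ge0 _.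
pose fw := frobenius (Dmx w); have fw_ge0 : 0 <= fw := frobenius_ge0 _.
pose C1 := 2 * (j * fx * j) + j ^+ 2.
have C1_ge0 : 0 <= C1 by rewrite addr_ge0 ?sqr_ge0 ?mulr_ge0.
pose c0 := \sum_i (x 0 i)^-1.
have xV_ge0 i : 0 <= (x 0 i)^-1 by rewrite invr_ge0 ltW ?x0.
have c0_ge0 : 0 <= c0 by apply: sumr_ge0.
have c0_le i : (x 0 i)^-1 <= c0 by rewrite /c0 (bigD1 i)//= lerDl sumr_ge0.
pose sw := \sum_i `|w 0 i|; have sw_ge0 : 0 <= sw by apply: sumr_ge0.
(* The part of [- (J (Dmx x + H))^2] that involves [H]; the rest is [Dmx d]. *)
pose E (H : 'M[R]_(n.+1 + n.+1)) :=
  - (J *m Dmx x *m (J *m H) + J *m H *m (J *m Dmx x) + J *m H *m (J *m H)).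
have frobJH H : frobenius (J *m H *m (J *m H)) <= j ^+ 2 * frobenius H ^+ 2.
  apply: le_trans (frobeniusM _ _) _; rewrite -exprMn expr2.
  by rewrite ler_pM ?frobenius_ge0 ?frobeniusM.
have EC H : frobenius H <= 1 -> frobenius (E H) <= C1 * frobenius H.
  move=> H1; rewrite frobeniusN; apply: le_trans (frobeniusD _ _) _.
  have H2 : frobenius (J *m Dmx x *m (J *m H)) <= j * fx * (j * frobenius H).
    apply: le_trans (frobeniusM _ _) _.
    by rewrite ler_pM ?frobenius_ge0 ?frobeniusM.
  have H3 : frobenius (J *m H *m (J *m Dmx x)) <= j * frobenius H * (j * fx).
    apply: le_trans (frobeniusM _ _) _.
    by rewrite ler_pM ?frobenius_ge0 ?frobeniusM.
  have H4 : j ^+ 2 * frobenius H ^+ 2 <= j ^+ 2 * frobenius H.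
    by rewrite ler_wpM2l ?sqr_ge0// expr2 ler_piMl ?frobenius_ge0.
  apply: le_trans (lerD (frobeniusD _ _) (frobJH H)) _.
  by apply: le_trans (lerD (lerD H2 H3) H4) _; rewrite /C1; lra.
(* Since [J] commutes with diagonal [Dmx] factors and [J J = -1], each of the two linear terms of
   [E H] contributes half of [\tr (Dmx g *m H)]. *)
have trE H : \tr (Dmx w *m E H) =
    \tr (Dmx g *m H) - \tr (Dmx w *m (J *m H *m (J *m H))).
  have wx : Dmx w *m Dmx x = 2^-1 *: Dmx g.
    rewrite Dmx_mul -DmxZ; congr Dmx; apply/rowP => i; rewrite !mxE.
    by field; rewrite gt_eqF ?x0.
  have xw : Dmx x *m Dmx w = 2^-1 *: Dmx g.
    by rewrite -wx !Dmx_mul; congr Dmx; apply/rowP => i; rewrite !mxE mulrC.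
  have a : \tr (Dmx w *m (J *m Dmx x *m (J *m H))) = - (2^-1 * \tr (Dmx g *m H)).
    rewrite Jmx_Dmx -(mulmxA (Dmx x)) (mulmxA J) mul_Jmx mulNmx mul1mx !mulmxN.
    by rewrite raddfN /= mulmxA wx -scalemxAl mxtraceZ.
  have b : \tr (Dmx w *m (J *m H *m (J *m Dmx x))) = - (2^-1 * \tr (Dmx g *m H)).
    rewrite mulmxA mxtrace_mulC Jmx_Dmx -(mulmxA (Dmx x)) (mulmxA (Dmx w)).
    rewrite -Jmx_Dmx !mulmxA -(mulmxA (Dmx x) J J) mul_Jmx mulmxN mulmx1 !mulNmx.
    by rewrite raddfN /= xw -scalemxAl mxtraceZ.
  by rewrite /E mulmxN raddfN /= !mulmxDr !mxtraceD a b; field.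
pose C3 := C1 * c0.
have C3_ge0 : 0 <= C3 by rewrite mulr_ge0.
(* [C3] bounds the displacement of the eigenvalues. The bracket collects the error of [perturb_Dmx],
   the quadratic sum [q] and the quadratic part of [E], halved because the expansion carries a
   factor 2. *)
pose C := C3 + (C2 * C1 ^+ 2 + 2 * (sw * C3 ^+ 2) + fw * j ^+ 2) / 2.
have C_ge : C3 <= C.
  by rewrite lerDl !(addr_ge0, mulr_ge0, sqr_ge0)// invr_ge0.
exists C, (Num.min 1 (delta / (C1 + 1))); split.
- exact: le_trans C_ge.
- by rewrite lt_min ltr01 divr_gt0// ltr_wpDl.
move=> y H N; rewrite le_min => /andP[H1 Hd] y0 sN DN.
have H_ge0 : 0 <= frobenius H := frobenius_ge0 _.
have Ed : frobenius (E H) <= delta.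
  apply: le_trans (EC _ H1) _; move: Hd; rewrite ler_pdivlMr ?ltr_wpDl//; nra.
pose t : 'rV[R]_n.+1 := \row_i y 0 i ^+ 2.
have := symplectic_sqr_conj sN DN; rewrite -/t => EN.
have {}EN : (Dmx d + E H) *m N = N *m Dmx t.
  rewrite -EN; congr (_ *m _); rewrite mulmxDr !mulmxDl !mulmxDr /E !opprD !addrA.
  do 3 congr (_ + _).
  rewrite !mulmxA -(mulmxA J) -Jmx_Dmx mulmxA mul_Jmx mulNmx mul1mx mulNmx opprK.
  by rewrite Dmx_mul; congr Dmx; apply/rowP => i; rewrite !mxE expr2.
have [tau [ytau sumtau]] := pert _ _ _ Ed (symplectic_unit sN) EN.
exists tau.
(* The bound on [y^2 - x^2] passes to [y - x] because [y + x >= x > 0]; [c0] dominates all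
   [1 / x_i]. *)
have yx i : `|y 0 (tau i) - x 0 i| <= C3 * frobenius H.
  have := le_trans (ytau i) (EC _ H1); rewrite !mxE subr_sqr normrM => h.
  have xy : x 0 i <= `|y 0 (tau i) + x 0 i|.
    by apply: le_trans (ler_norm _); rewrite lerDr ltW ?y0.
  have h2 : `|y 0 (tau i) - x 0 i| * x 0 i <= C1 * frobenius H.
    by apply: le_trans h; rewrite ler_wpM2l.
  rewrite -ler_pdivlMr ?x0// in h2; apply: le_trans h2 _.
  by rewrite /C3 mulrAC ler_wpM2r ?ler_wpM2l.
split => [i|]; first by apply: le_trans (yx i) _; rewrite ler_wpM2r.
pose q := \sum_i w 0 i * (y 0 (tau i) - x 0 i) ^+ 2.
have q_le : `|q| <= sw * (C3 * frobenius H) ^+ 2.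
  apply: le_trans (ler_norm_sum _ _ _) _; rewrite mulr_suml ler_sum// => i _.
  rewrite normrM ler_wpM2l// ger0_norm ?sqr_ge0// -[leLHS]real_normK ?num_real//.
  by rewrite ler_pXn2r ?nnegrE ?mulr_ge0.
move: sumtau; rewrite trE.
have -> : 2 * \sum_i w 0 i * (t 0 (tau i) - d 0 i) =
    2 * (\sum_i g 0 i * (y 0 (tau i) - x 0 i)) + 2 * q.
  rewrite -mulrDr -big_split; congr (_ * _); apply: eq_bigr => i _.
  by rewrite !mxE /=; field; rewrite gt_eqF ?x0.
set S := \sum_i g 0 i * _; set T := \tr (Dmx g *m H); set Q := \tr _ => h.
have hQ : `|Q| <= fw * (j ^+ 2 * frobenius H ^+ 2).
  by apply: le_trans (mxtrace_mul_le_frobenius _ _) _; rewrite ler_wpM2l.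
have hE : C2 * frobenius (E H) ^+ 2 <= C2 * (C1 * frobenius H) ^+ 2.
  by rewrite ler_wpM2l// ler_pXn2r ?nnegrE ?frobenius_ge0 ?mulr_ge0 ?EC.
have {}h := le_trans h hE.
have hC : 0 <= C3 * frobenius H ^+ 2 by rewrite mulr_ge0 ?sqr_ge0.
move: h hQ q_le; rewrite /C !exprMn !ler_norml => /andP[? ?] /andP[? ?] /andP[? ?].
by apply/andP; split; lra.
Qed.
End SymplecticPerturbation.

Lemma mxdot_mulmxr (R : realType) k m n (B : 'M[R]_(k, m)) (u : 'M[R]_(m, n)) v :
  mxdot v (B *m u) = mxdot (B^T *m v) u.
Proof. by rewrite /mxdot trmx_mul trmxK mulmxA. Qed.

(** * Rayleigh quotients and eigenvectors under linear constraints *)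

Section GeneralizedEigenvector.
Context {R : realType} {m : nat}.
Implicit Types (S G : 'M[R]_m) (u v w y : 'cV[R]_m).

Lemma quadratic_form_continuous G :
  continuous (fun r : 'rV[R]_m => mxdot r^T (G *m r^T)).
Proof.
pose F (r : 'rV[R]_m) := \sum_i \sum_j r 0 i * (G i j * r 0 j).
have -> : (fun r : 'rV[R]_m => mxdot r^T (G *m r^T)) = F.
  apply/funext => r; rewrite mxdotE; apply: eq_bigr => i _.
  rewrite big_ord1 !mxE mulr_sumr; apply: eq_bigr => j _.
  by rewrite mxE.
have sumC k (h : 'I_k -> 'rV[R]_m -> R) : (forall i, continuous (h i)) ->
    continuous (fun r => \sum_i h i r).
  by move=> hC; apply: continuous_big => //; apply: add_continuous.
apply: (sumC _ _) => i; apply: (sumC _ _) => j r.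
have coordC k : (fun t : 'rV[R]_m => t 0 k) @ r --> r 0 k.
  exact: (@coord_continuous R 1 m 0 k r).
by apply: (@cvgM _ _ (nbhs r)) => //; apply: (@cvgM _ _ (nbhs r)) => //; exact: cvg_cst.
Qed.

Lemma mxdot_gt0 u : u != 0 -> 0 < mxdot u u.
Proof.
move=> u0; rewrite lt_neqAle mxdot_ge0 andbT eq_sym.
by apply: contra u0 => /eqP/mxdot_eq0 ->.
Qed.

(** The quotient is continuous on the compact Euclidean unit sphere of [ker C]. A maximiser there is
    rescaled to [S]-norm 1, and homogeneity extends the inequality to all of [ker C]. *)
Lemma exists_max_generalized_rayleigh k S G (C : 'M[R]_(k, m)) :
  (forall v, v != 0 -> 0 < mxdot v (S *m v)) ->
  (exists2 v : 'cV[R]_m, v != 0 & C *m v = 0) ->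
  exists (y : 'cV[R]_m) (mu : R), [/\ C *m y = 0, mxdot y (S *m y) = 1,
    mxdot y (G *m y) = mu &
    forall v, C *m v = 0 -> mxdot v (G *m v) <= mu * mxdot v (S *m v)].
Proof.
move=> Spos [v0 v0_neq0 Cv0].
(* Both conditions are level sets of quadratic forms, the second being the squared norm of [C r^T],
   so one continuity lemma makes [A] closed. *)
pose A : set 'rV[R]_m := [set r | mxdot r^T (1%:M *m r^T) = 1] `&`
  [set r | mxdot r^T (C^T *m C *m r^T) = 0].
have AE (r : 'rV[R]_m) : A r <-> mxdot r^T r^T = 1 /\ C *m r^T = 0.
  rewrite /A /= mul1mx -mulmxA mxdot_mulmxr trmxK; split=> -[-> h]; split=> //.
    exact: mxdot_eq0.
  by rewrite h /mxdot mulmx0 mxtrace0.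
have normalize v : v != 0 -> C *m v = 0 -> A ((frobenius v)^-1 *: v)^T.
  move=> v_neq0 Cv; apply/AE; rewrite trmxK -scalemxAr Cv scaler0; split => //.
  rewrite mxdotZl mxdotZr -sqr_frobenius expr2 mulrA; field.
  by apply: contra_neq v_neq0 => /frobenius_eq0.
have A_compact : compact A.
  apply: bounded_closed_compact.
    exists 1; split => // M M1 r /AE[r1 _]; apply: le_trans (ltW M1).
    rewrite -[leLHS]/(mx_norm r) mx_normrE; apply/bigmax_leP; split => // ij _ /=.
    apply: le_trans (entry_le_frobenius _ _ _) _.
    by rewrite -frobenius_tr /frobenius r1 sqrtr1.
  apply: closedI; apply: (@preimage_closed _ _ _ [set _]) => //; try exact: closed_eq.
    by move=> r _; apply: quadratic_form_continuous.
  by move=> r _; apply: quadratic_form_continuous.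
pose q B (r : 'rV[R]_m) := mxdot r^T (B *m r^T).
have S_neq0 r : A r -> q S r != 0.
  move=> /AE[r1 _]; rewrite gt_eqF// Spos//; apply: contra_eq_neq r1 => ->.
  by rewrite /mxdot mulmx0 mxtrace0 eq_sym oner_neq0.
have [c] : exists2 c, c \in A & forall t, t \in A -> q G t / q S t <= q G c / q S c.
  apply: compact_EVT_max => //.
    by exists ((frobenius v0)^-1 *: v0)^T; apply: normalize.
  apply: continuous_in_subspaceT => r /set_mem Ar.
  apply: (@cvgM _ _ (nbhs r)); first exact: quadratic_form_continuous.
  by apply: (@cvgV _ _ (nbhs r)); [exact: S_neq0|exact: quadratic_form_continuous].
rewrite inE => Ac cmax.
have [_ Cc] := (AE c).1 Ac.
have Sc : 0 < q S c.
  apply: Spos; apply: contra_neq (S_neq0 c Ac) => c0.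
  by rewrite /q c0 mulmx0 /mxdot mulmx0 mxtrace0.
exists ((Num.sqrt (q S c))^-1 *: c^T), (q G c / q S c).
have sq : (Num.sqrt (q S c)) ^-1 * (Num.sqrt (q S c))^-1 = (q S c)^-1.
  by rewrite -expr2 exprVn sqr_sqrtr// ltW.
split.
- by rewrite -scalemxAr Cc scaler0.
- by rewrite -scalemxAr mxdotZl mxdotZr mulrA sq mulVf// S_neq0.
- by rewrite -scalemxAr mxdotZl mxdotZr mulrA sq mulrC.
move=> v Cv; have [->|v_neq0] := eqVneq v 0.
  by rewrite !mulmx0 /mxdot !mulmx0 mxtrace0 mulr0.
have f0 : frobenius v != 0 by apply: contra_neq v_neq0 => /frobenius_eq0.
rewrite -ler_pdivrMr ?Spos//.
have := cmax _ (mem_set (normalize v v_neq0 Cv)); congr (_ <= _).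
rewrite /q !trmxK -!scalemxAr !mxdotZl !mxdotZr !mulrA -mulf_div divff ?mul1r//.
by rewrite mulf_neq0// invr_eq0.
Qed.

(* [y] maximises the Rayleigh quotient, so the form [mu S - G] is positive
   semidefinite on [ker C] and vanishes at [y], hence has [y] in its radical. *)
Lemma exists_constrained_eigenvector k S G (C : 'M[R]_(k, m)) :
  S^T = S -> G^T = G -> (forall v, v != 0 -> 0 < mxdot v (S *m v)) -> (k < m)%N ->
  exists (y : 'cV[R]_m) (mu : R), [/\ C *m y = 0, mxdot y (S *m y) = 1,
    forall v, C *m v = 0 -> mxdot v (G *m v) <= mu * mxdot v (S *m v) &
    forall w, C *m w = 0 -> mxdot w (G *m y) = mu * mxdot w (S *m y)].
Proof.
move=> symS symG Spos km.
have [v v_neq0 Cv] : exists2 v : 'cV[R]_m, v != 0 & C *m v = 0.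
  have : kermx C^T != 0.
    rewrite kermx_eq0 /row_free neq_ltn (leq_ltn_trans _ km)//.
    by rewrite mxrank_tr rank_leq_row.
  move=> /rowV0Pn[r /sub_kermxP rC r0]; exists r^T.
    by apply: contra_neq r0 => /(congr1 trmx); rewrite trmxK trmx0.
  by rewrite -[C]trmxK -trmx_mul rC trmx0.
have [y [mu [Cy Sy Gy ymax]]] :=
  exists_max_generalized_rayleigh G Spos (ex_intro2 _ _ v v_neq0 Cv).
exists y, mu; split => // w Cw.
pose a := mu * mxdot w (S *m y) - mxdot w (G *m y).
pose b := mu * mxdot w (S *m w) - mxdot w (G *m w).
have b_ge0 : 0 <= b by rewrite subr_ge0 ymax.
have sym B : B^T = B -> mxdot y (B *m w) = mxdot w (B *m y).
  by move=> sB; rewrite mxdot_mulmxr sB mxdotC.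
have psd s : 0 <= 2 * s * a + s ^+ 2 * b.
  have Cs : C *m (y + s *: w) = 0 by rewrite mulmxDr -scalemxAr Cy Cw scaler0 addr0.
  have := ymax _ Cs.
  rewrite !mulmxDr -!scalemxAr !(mxdotDl, mxdotDr, mxdotZl, mxdotZr) !sym// Sy Gy.
  by rewrite /a /b => h; lra.
(* This choice makes the expression negative unless [a = 0]; [b + 1] replaces [b], which may
   vanish. *)
have := psd (- a / (b + 1)).
have b1 : 0 < b + 1 by rewrite ltr_wpDl.
have -> : 2 * (- a / (b + 1)) * a + (- a / (b + 1)) ^+ 2 * b =
    - (a ^+ 2 * (b + 2) / (b + 1) ^+ 2) by field; rewrite gt_eqF.
rewrite oppr_ge0 ler_pdivrMr ?exprn_gt0// mul0r pmulr_lle0 ?ltr_wpDl// => a0.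
have : a == 0 by rewrite -sqrf_eq0 eq_le a0 sqr_ge0.
by rewrite /a subr_eq0 => /eqP.
Qed.

End GeneralizedEigenvector.

(** * Williamson's theorem, existence part *)

Section Williamson.
Context {R : realType} {n : nat}.
Variable S : 'M[R]_(n + n).
Hypothesis S_sym : S^T = S.
Hypothesis S_pos : forall v : 'cV[R]_(n + n), v != 0 -> 0 < mxdot v (S *m v).
Local Notation vec := 'cV[R]_(n + n).
Local Notation J := (@Jmx R n).

Let ip (u v : vec) : R := mxdot u (S *m v).
(** [T] is skew for the inner product [ip] defined by [S]. It acts on invariant planes as a rotation
    scaled by [lam], and the symplectic eigenvalues are the reciprocals of these scales. *)
Let T : 'M[R]_(n + n) := invmx S *m J.

Let ipC u v : ip u v = ip v u.
Proof. by rewrite /ip mxdot_mulmxr S_sym mxdotC. Qed.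

Let ipDr u v w : ip u (v + w) = ip u v + ip u w.
Proof. by rewrite /ip mulmxDr mxdotDr. Qed.

Let ipZr a u v : ip u (a *: v) = a * ip u v.
Proof. by rewrite /ip -scalemxAr mxdotZr. Qed.

Let ipZl a u v : ip (a *: u) v = a * ip u v.
Proof. by rewrite ipC ipZr ipC. Qed.

Let ip_eq0 u : ip u u = 0 -> u = 0.
Proof. by move=> u0; apply: contra_eq u0 => /S_pos /lt0r_neq0. Qed.

Let S_unit : S \in unitmx.
Proof.
rewrite -row_free_unit -kermx_eq0; apply/negPn/negP => /rowV0Pn[r /sub_kermxP rS r0].
have : r^T != 0 by apply: contra_neq r0 => /(congr1 trmx); rewrite trmxK trmx0.
by move=> /S_pos; rewrite mxdot_mulmxr S_sym -[S]S_sym -trmx_mul rS trmx0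
  /mxdot trmx0 mul0mx mxtrace0 ltxx.
Qed.

Let ip_T u v : ip u (T *m v) = mxdot u (J *m v).
Proof. by rewrite /ip /T !mulmxA mulmxV// mul1mx. Qed.

Let ip_T_skew u v : ip u (T *m v) = - ip (T *m u) v.
Proof.
rewrite ip_T ipC ip_T mxdot_mulmxr tr_Jmx mulNmx mxdotC.
by rewrite -scaleN1r mxdotZr mulN1r.
Qed.

Let T_unit : T \in unitmx.
Proof.
rewrite unitmx_mul unitmx_inv S_unit /=.
by have /mulmx1_unit[] : - J *m J = 1%:M by rewrite mulNmx mul_Jmx opprK.
Qed.

(* The last clause records that the [lam i] are chosen greedily, in decreasing
   order, which sorts the symplectic eigenvalues [1 / lam i]. *)
Let partial_basis k (u v : nat -> vec) (lam : nat -> R) :=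
  [/\ forall i, (i < k)%N ->
        [/\ 0 < lam i, T *m v i = lam i *: u i & T *m u i = - lam i *: v i],
      forall i j, (i < k)%N -> (j < k)%N ->
        [/\ ip (u i) (u j) = (i == j)%:R, ip (v i) (v j) = (i == j)%:R
          & ip (u i) (v j) = 0]
    & forall i w, (i < k)%N ->
        (forall j, (j < i)%N -> ip (u j) w = 0 /\ ip (v j) w = 0) ->
        ip (T *m w) (T *m w) <= lam i ^+ 2 * ip w w].

(** The [ip]-complement of the pairs found so far is [T]-invariant by skewness. A maximiser [y] of
    [ip (T w) (T w) / ip w w] on it satisfies [T^2 y = - mu y], so [y] and [T y / sqrt mu] form the
    next pair. *)
Let exists_partial_basis k : (k <= n)%N -> exists u v lam, partial_basis k u v lam.
Proof.
clearbody T; elim: k => [_|k IH kn].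
  by exists (fun=> 0), (fun=> 0), (fun=> 0); split.
have [u [v [lam [eig orth greedy]]]] := IH (ltnW kn).
(* The kernel of [C] is the [ip]-complement of all earlier [u i] and [v i]. *)
pose C : 'M[R]_(k + k, n + n) :=
  col_mx (\matrix_(i < k) (S *m u i)^T) (\matrix_(i < k) (S *m v i)^T).
have rowsE (a : nat -> vec) (w : vec) :
    (\matrix_(i < k) (S *m a i)^T) *m w = \col_(i < k) ip w (a i).
  apply/colP => i; rewrite mxE [RHS]mxE /ip mxdotE; apply: eq_bigr => l _.
  by rewrite big_ord1 !mxE mulrC.
have CE (w : vec) : C *m w = 0 <->
    forall i, (i < k)%N -> ip (u i) w = 0 /\ ip (v i) w = 0.
  rewrite mul_col_mx !rowsE; split=> [/eqP|h].
    rewrite col_mx_eq0 => /andP[/eqP/colP hu /eqP/colP hv] i ik.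
    by have := hu (Ordinal ik); have := hv (Ordinal ik); rewrite !mxE /= !(ipC w).
  apply/eqP; rewrite col_mx_eq0; apply/andP; split; apply/eqP/colP => i;
    rewrite !mxE ipC; by have [] := h i (ltn_ord i).
pose G := T^T *m S *m T.
have GE (a b : vec) : mxdot a (G *m b) = ip (T *m a) (T *m b).
  by rewrite /ip /G -!mulmxA mxdot_mulmxr trmxK.
have G_sym : G^T = G by rewrite /G !trmx_mul trmxK S_sym mulmxA.
have kn2 : (k + k < n + n)%N by rewrite -addSn leq_add// ltnW.
have [y [mu [Cy Sy ymax yeig]]] :=
  exists_constrained_eigenvector C S_sym G_sym S_pos kn2.
have y_neq0 : y != 0.
  apply: contra_eq_neq Sy => ->.
  by rewrite /mxdot trmx0 mul0mx mxtrace0 eq_sym oner_neq0.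
have Ty_neq0 : T *m y != 0.
  by apply: contra_neq y_neq0 => Ty; rewrite -(mulKmx T_unit y) Ty mulmx0.
have mu_gt0 : 0 < mu.
  by have := yeig y Cy; rewrite Sy mulr1 GE => <-; apply: S_pos.
pose l := Num.sqrt mu.
have l_gt0 : 0 < l by rewrite sqrtr_gt0.
have l2 : l ^+ 2 = mu by rewrite sqr_sqrtr// ltW.
have T_inv (w : vec) : C *m w = 0 -> C *m (T *m w) = 0.
  move=> /CE Cw; apply/CE => i ik; have [_ Tv Tu] := eig i ik; have [uw vw] := Cw i ik.
  by rewrite !ip_T_skew Tu Tv !ipZl uw vw !mulr0 oppr0.
(* The vector [w = T^2 y + mu y] lies in the complement, and skewness with the eigenvector relation
   tested on [w] gives [ip w w = 0]. *)
have TTy : T *m (T *m y) = - mu *: y.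
  apply/eqP; rewrite scaleNr -addr_eq0; apply/eqP/ip_eq0.
  set w := _ + _.
  have Cw : C *m w = 0 by rewrite mulmxDr -scalemxAr Cy scaler0 addr0 !T_inv.
  have := yeig w Cw; rewrite GE -[LHS]opprK -[in LHS]mulN1r => h.
  rewrite {2}/w ipDr ipZr ip_T_skew.
  by move: h; rewrite mulN1r opprK => ->; rewrite addNr.
have [uy vy] : (forall i, (i < k)%N -> ip (u i) y = 0) /\
    (forall i, (i < k)%N -> ip (v i) y = 0).
  by split => i ik; have [] := (CE y).1 Cy i ik.
have [uTy vTy] : (forall i, (i < k)%N -> ip (u i) (T *m y) = 0) /\
    (forall i, (i < k)%N -> ip (v i) (T *m y) = 0).
  by split => i ik; have [] := (CE _).1 (T_inv _ Cy) i ik.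
pose x := l^-1 *: (T *m y).
exists (fun i => if i == k then x else u i), (fun i => if i == k then y else v i),
  (fun i => if i == k then l else lam i).
have yy : ip y y = 1 by [].
have yTy : ip y (T *m y) = 0.
  by apply/eqP; have := ip_T_skew y y; rewrite (ipC (T *m y)) => /eqP;
    rewrite -addr_eq0 -mulr2n mulrn_eq0.
have xx : ip x x = 1.
  rewrite ipZl ipZr -GE (yeig _ Cy) [mxdot _ _]yy mulr1 -l2.
  by field; rewrite gt_eqF.
split.
- move=> i; rewrite ltnS leq_eqVlt; case: eqVneq => [_ _|_ /= ik]; last exact: eig.
  split => //; first by rewrite scalerA mulfV ?scale1r// gt_eqF.
  rewrite -scalemxAr TTy scalerA -l2; congr (_ *: _).
  by field; rewrite gt_eqF.
- move=> i j; rewrite !ltnS (leq_eqVlt i) (leq_eqVlt j).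
  case: (eqVneq i k) => [->|ik] /=; case: (eqVneq j k) => [->|jk] //= hi hj.
  + by rewrite xx yy ipZl ipC yTy mulr0.
  + rewrite !(ipC x) !(ipC y) !ipZr uTy// vTy// vy//.
    by rewrite !mulr0.
  + by rewrite ipZr uTy// uy// vy// (negPf ik) mulr0.
  + exact: orth.
move=> i w; rewrite ltnS leq_eqVlt; case: eqVneq => [-> _ h|ik /= hi h].
  have {}h j : (j < k)%N -> ip (u j) w = 0 /\ ip (v j) w = 0.
    by move=> jk; have := h j jk; rewrite (ltn_eqF jk).
  by rewrite l2 -GE; apply: ymax; apply/CE.
apply: greedy => // j ji; have := h j ji.
by rewrite (ltn_eqF (ltn_trans ji hi)).
Qed.

Lemma mul_tr_mxE (X Y : 'M[R]_(n + n, n)) (B : 'M[R]_(n + n)) i j :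
  (X^T *m B *m Y) i j = mxdot (col i X) (B *m col j Y).
Proof.
rewrite /mxdot mulmxA tr_col -row_mul colE mulmxA -colE -row_mul.
by rewrite /mxtrace big_ord1 !mxE.
Qed.

(** Scaling [u i] and [v i] by [1 / sqrt (lam i)] turns their [J]-pairing, which is [lam i], into 1
    and their squared [ip]-norm into [1 / lam i]; these vectors are the columns of the symplectic
    matrix. *)
Lemma williamson : exists x, is_sympl_eigs S x.
Proof.
have [u [v [lam [eig orth greedy]]]] := exists_partial_basis (leqnn n).
have l0 (i : 'I_n) : 0 < lam i by have [] := eig i (ltn_ord i).
pose s (i : 'I_n) := (Num.sqrt (lam i))^-1.
have s2 i : s i * s i = (lam i)^-1.
  by rewrite /s -expr2 exprVn sqr_sqrtr// ltW.
exists (\row_i (lam i)^-1); split.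
- by move=> i; rewrite mxE invr_gt0.
(* For [i <= j], [v j] is orthogonal to the pairs before [i], so the greedy clause at [i] gives
   [lam j <= lam i]. *)
- move=> i j ij; rewrite !mxE lef_pV2 ?posrE//.
  have [_ Tv _] := eig j (ltn_ord j).
  have [uu vv _] := orth j j (ltn_ord j) (ltn_ord j).
  have := greedy i (v j) (ltn_ord i); rewrite Tv ipZl ipZr uu vv eqxx !mulr1 -expr2.
  rewrite ler_pXn2r ?nnegrE ?(ltW (l0 _))// => h; apply: h => k ki.
  have kj : (k < j)%N := leq_trans ki ij.
  have kn := ltn_trans kj (ltn_ord j).
  have [_ vkj ukj] := orth k j kn (ltn_ord j).
  by rewrite ukj vkj (ltn_eqF kj).
pose U := \matrix_(r < n + n, i < n) (s i * u i r 0).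
pose V := \matrix_(r < n + n, i < n) (s i * v i r 0).
have colU i : col i U = s i *: u i by apply/colP => r; rewrite !mxE.
have colV i : col i V = s i *: v i by apply/colP => r; rewrite !mxE.
have form (B : 'M[R]_(n + n)) : (row_mx U V)^T *m B *m row_mx U V =
    block_mx (U^T *m B *m U) (U^T *m B *m V) (V^T *m B *m U) (V^T *m B *m V).
  by rewrite tr_row_mx mul_col_mx mul_col_row.
have lamd i j : s i * (s j * (lam j * (i == j)%:R)) = (i == j)%:R :> R.
  case: eqVneq => [->|_]; last by rewrite !mulr0.
  by rewrite mulr1 mulrA s2 mulVf// gt_eqF.
have [UJU UJV VJU VJV] : [/\ U^T *m J *m U = 0, U^T *m J *m V = 1%:M,
    V^T *m J *m U = - 1%:M & V^T *m J *m V = 0].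
  split; apply/matrixP => i j; rewrite mul_tr_mxE ?colU ?colV -scalemxAr mxdotZl mxdotZr;
    rewrite -ip_T; have [_ Tv Tu] := eig j (ltn_ord j);
    have [uu vv uv] := orth i j (ltn_ord i) (ltn_ord j);
    have [_ _ vu] := orth j i (ltn_ord j) (ltn_ord i).
  - by rewrite Tu ipZr uv !mulr0 mxE.
  - by rewrite Tv ipZr uu lamd mxE.
  - by rewrite Tu ipZr vv mulNr !mulrN lamd !mxE.
  - by rewrite Tv ipZr ipC vu !mulr0 mxE.
have diag i j : s i * (s j * (i == j)%:R) = (\row_i (lam i)^-1) 0 i *+ (i == j) :> R.
  rewrite mxE; case: eqVneq => [->|_]; last by rewrite !mulr0.
  by rewrite mulr1 s2.
have [USU USV VSU VSV] : [/\ U^T *m S *m U = diag_mx (\row_i (lam i)^-1),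
    U^T *m S *m V = 0, V^T *m S *m U = 0 & V^T *m S *m V = diag_mx (\row_i (lam i)^-1)].
  split; apply/matrixP => i j; rewrite mul_tr_mxE ?colU ?colV -scalemxAr mxdotZl mxdotZr;
    have [uu vv uv] := orth i j (ltn_ord i) (ltn_ord j);
    have [_ _ vu] := orth j i (ltn_ord j) (ltn_ord i); rewrite -/(ip _ _).
  - by rewrite uu diag [RHS]mxE.
  - by rewrite uv !mulr0 mxE.
  - by rewrite ipC vu !mulr0 mxE.
  - by rewrite vv diag [RHS]mxE.
exists (row_mx U V); first by rewrite /symplectic form UJU UJV VJU VJV.
by rewrite form USU USV VSU VSV.
Qed.
End Williamson.

(** * Differentiability through remainder estimates *)

Section FrechetDerivative.
Context {R : realType} {V : normedModType R}.
Implicit Types (f : V -> R) (x h : V).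

Lemma linear_bound_continuous (W : normedModType R) (l : {linear V -> W}) (C : R) :
  (forall h, `|l h| <= C * `|h|) -> continuous l.
Proof.
move=> lC; suff : bounded_near l (nbhs 0) by move/linear_bounded_continuous.
rewrite /bounded_near; near=> K; near=> h => /=.
apply: le_trans (lC h) _; apply: le_trans (_ : `|C| * 1 <= _).
  apply: le_trans (_ : `|C| * `|h| <= _); first by rewrite ler_wpM2r// ler_norm.
  by rewrite ler_wpM2l// ltW//; near: h; apply: nbhs0_lt.
by rewrite mulr1; near: K; apply: nbhs_pinfty_ge; rewrite num_real.
Unshelve. all: by end_near. Qed.

Lemma differentiable_remainder f x : differentiable f x ->
  forall eps, 0 < eps -> exists2 delta, 0 < delta &
    forall h, `|h| < delta -> `|f (x + h) - f x - 'd f x h| <= eps * `|h|.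
Proof.
move=> /diff_locallyP[_ /eqaddoP fx] eps eps_gt0.
have /nbhs_norm0P[delta /= delta_gt0 Hdelta] := fx _ eps_gt0.
exists delta => // h hd; have := Hdelta h hd.
by rewrite /= !fctE /= opprD addrA [h + x]addrC.
Qed.

Lemma differentiable_of_remainder f x (l : {linear V -> R}) : continuous l ->
  (forall eps, 0 < eps -> exists2 delta, 0 < delta &
    forall h, `|h| < delta -> `|f (x + h) - f x - l h| <= eps * `|h|) ->
  differentiable f x /\ 'd f x = l :> (V -> R).
Proof.
move=> l_cont rem.
have fxl : f \o shift x = cst (f x) + l +o_ 0 id.
  apply/eqaddoP => eps eps_gt0; apply/nbhs_norm0P.
  have [delta delta_gt0 Hdelta] := rem _ eps_gt0.
  exists delta => //= h hd; have := Hdelta h hd.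
  by rewrite /= !fctE /= opprD addrA [h + x]addrC.
have dfl : 'd f x = l :> (V -> R) by apply: diff_unique.
by split => //; apply/diff_locallyP; rewrite dfl.
Qed.

End FrechetDerivative.

(** * Positive vectors and gradients of symmetric functions *)

Section RowVectors.
Context {R : realType} {n : nat}.
Implicit Types (x y g h : 'rV[R]_n) (f : 'rV[R]_n -> R).

Lemma row_norm_le h (e : R) : 0 <= e -> (forall i, `|h 0 i| <= e) -> `|h| <= e.
Proof.
move=> e0 he; rewrite -[leLHS]/(mx_norm h) mx_normrE; apply/bigmax_leP.
split => // -[i j] _.
by rewrite /= ord1.
Qed.

Lemma row_entry_le_norm h i : `|h 0 i| <= `|h|.
Proof.
rewrite -[leRHS]/(mx_norm h) mx_normrE; apply/bigmax_geP; right.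
by exists (0, i).
Qed.

Lemma posvec_lower_bound x : posvec x -> exists2 c, 0 < c & forall i, c <= x 0 i.
Proof.
move=> x0; have xV_ge0 i : 0 <= (x 0 i)^-1 by rewrite invr_ge0 ltW ?x0.
pose s := 1 + \sum_i (x 0 i)^-1.
have s_gt0 : 0 < s by rewrite ltr_wpDr ?sumr_ge0.
exists s^-1 => [|i]; first by rewrite invr_gt0.
rewrite invf_ple ?posrE ?x0// /s (bigD1 i)//= addrCA lerDl addr_ge0//.
exact: sumr_ge0.
Qed.

(** The vector of partial derivatives represents the differential, so [xget] does not fall back on
    its default. *)
Lemma diff_row_mxdot f x : differentiable f x ->
  forall h, 'd f x h = mxdot (grad_vec f x) h.
Proof.
move=> fx; rewrite /grad_vec /gradient.
case: xgetP => [g -> //|/(_ (\row_i 'd f x (delta_mx 0 i))) /= []] h.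
rewrite mxdotE big_ord1 {1}[h]row_sum_delta linear_sum; apply: eq_bigr => i _.
by rewrite linearZ /= mxE mulrC.
Qed.

Lemma symmetric_fun_perm f x y (s : 'S_n) : symmetric_fun f -> posvec x ->
  (forall i, y 0 i = x 0 (s i)) -> f y = f x.
Proof.
move=> f_sym x0 yx; rewrite -(f_sym x (perm_mx (s^-1)) x0) ?perm_mx_is_perm//.
by congr f; rewrite -col_permE; apply/rowP => i; rewrite mxE.
Qed.

(** Equal steps [t] along coordinates [i] and [j] reach points exchanged by a transposition, where
    [f] agrees. Hence [t g_i] and [t g_j] differ by [o(t)]. *)
Lemma grad_vec_block_constant f x : symmetric_fun f -> posvec x ->
  differentiable f x ->
  forall i j, x 0 i = x 0 j -> grad_vec f x 0 i = grad_vec f x 0 j.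
Proof.
move=> f_sym x0 fx i j xij; set g := grad_vec f x.
have [c c_gt0 cx] := posvec_lower_bound x0.
apply/eqP; rewrite -subr_eq0 -normr_le0; apply/ler_addgt0Pr => eps eps_gt0.
rewrite add0r.
have eps2_gt0 : 0 < eps / 2 by rewrite divr_gt0.
have [delta delta_gt0 rem] := differentiable_remainder fx eps2_gt0.
(* The first bound puts the steps within the remainder estimate, the second keeps [x + h k]
   positive. *)
pose t := Num.min (delta / 2) (c / 2).
have t_gt0 : 0 < t by rewrite lt_min !divr_gt0.
pose h k : 'rV[R]_n := t *: delta_mx 0 k.
have hE k l : h k 0 l = t * (l == k)%:R by rewrite !mxE eqxx.
have h_le k : `|h k| <= t.
  apply: row_norm_le => [|l]; first exact: ltW.
  rewrite hE normrM (gtr0_norm t_gt0) ler_piMr ?(ltW t_gt0)//.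
  by case: eqP; rewrite ?normr1 ?normr0.
have h_lt k : `|h k| < delta.
  apply: le_lt_trans (h_le k) _; rewrite gt_min; apply/orP; left; lra.
have xh_pos k : posvec (x + h k).
  move=> l; rewrite mxE; have := row_entry_le_norm (h k) l; have := h_le k.
  have : t <= c / 2 by rewrite ge_min lexx orbT.
  have := cx l; rewrite ler_norml => ? ? ? /andP[? ?]; lra.
have gh k : mxdot g (h k) = t * g 0 k.
  rewrite mxdotE big_ord1 (bigD1 k)//= hE eqxx mulr1 big1 ?addr0 1?mulrC// => l lk.
  by rewrite hE (negPf lk) !mulr0.
have fij : f (x + h j) = f (x + h i).
  apply: (@symmetric_fun_perm _ _ _ (tperm i j)) => // l.
  rewrite mxE [RHS]mxE !hE; case: tpermP => [->|->|/eqP li /eqP lj].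
  - by rewrite xij eq_sym.
  - by rewrite xij !eqxx.
  - by rewrite (negPf li) (negPf lj).
have := rem _ (h_lt i); have := rem _ (h_lt j).
rewrite !diff_row_mxdot// -/g !gh fij => remj remi.
have tg : t * `|g 0 i - g 0 j| <= t * eps.
  rewrite -[X in X * `|_|](gtr0_norm t_gt0) -normrM.
  have hi : eps / 2 * `|h i| <= eps / 2 * t by rewrite ler_wpM2l// ltW.
  have hj : eps / 2 * `|h j| <= eps / 2 * t by rewrite ler_wpM2l// ltW.
  have {remi hi} := le_trans remi hi; have {remj hj} := le_trans remj hj.
  by rewrite !ler_norml => /andP[? ?] /andP[? ?]; apply/andP; split; lra.
by rewrite -(ler_pM2l t_gt0).
Qed.

End RowVectors.

(** * Linear functionals and positivity on symmetric matrices *)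

Section SymmetricMatrices.
Context {R : realType} {m : nat}.

Lemma tr_symmx (A : symmx R m) : (mx_of_sym A)^T = A.
Proof. by have := valP A; rewrite symmx_predE => /eqP <-. Qed.

Lemma sym_congr_subproof k (N : 'M[R]_(m, k)) (D : 'M[R]_k) :
  D^T = D -> N *m D *m N^T \in symmx_pred R m.
Proof. by move=> DT; rewrite symmx_predE !trmx_mul trmxK DT mulmxA. Qed.

(** Packaged on [symmx] so that it carries a linear structure and can serve as a candidate
    differential. *)
Definition mxdot_sym (G : 'M[R]_m) (H : symmx R m) : R := mxdot G H.

Fact mxdot_sym_linear G : linear (mxdot_sym G).
Proof. by move=> a H K; rewrite /mxdot_sym mxdotDr mxdotZr. Qed.

HB.instance Definition _ G :=
  GRing.isLinear.Build R (symmx R m) R *:%R (mxdot_sym G) (mxdot_sym_linear G).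

Lemma mxdot_sym_continuous G : continuous (mxdot_sym G).
Proof.
by apply: (@linear_bound_continuous _ _ _ _ (frobenius G)) => H;
  apply: mxdot_le_frobenius.
Qed.

Lemma posdefE (A : symmx R m) :
  posdef A <-> forall v : 'cV[R]_m, v != 0 -> 0 < mxdot v ((mx_of_sym A) *m v).
Proof.
have E (v : 'cV[R]_m) : (v^T *m A *m v) 0 0 = mxdot v ((mx_of_sym A) *m v).
  by rewrite /mxdot mulmxA /mxtrace big_ord1.
by split => h v v0; have := h v v0; rewrite E.
Qed.

End SymmetricMatrices.

(** * Congruence images of [Dmx] and stability of positive definiteness *)

Section SymplecticCongruence.
Context {R : realType} {n : nat}.
Implicit Types (A H : symmx R (n + n)) (x y : 'rV[R]_n).

(** Used with [N = M] for the gradient, and with the inverse transpose of [M] for a linear path of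
    matrices through [A]. *)
Definition sym_congr (N : 'M[R]_(n + n)) x : symmx R (n + n) :=
  SymMx (sym_congr_subproof N (tr_Dmx x)).

Fact sym_congr_linear N : linear (sym_congr N).
Proof.
move=> a x y; apply: val_inj.
by rewrite /= DmxD DmxZ mulmxDr mulmxDl -scalemxAr -scalemxAl.
Qed.

HB.instance Definition _ N :=
  GRing.isLinear.Build R 'rV[R]_n (symmx R (n + n)) *:%R
    (sym_congr N) (sym_congr_linear N).

Lemma sym_congr_continuous N : continuous (sym_congr N).
Proof.
apply: (@linear_bound_continuous _ _ _ _ (frobenius N * (2 * n%:R) * frobenius N)) => x.
rewrite -[leLHS]/(frobenius (N *m Dmx x *m N^T)).
apply: le_trans (frobeniusM _ _) _; rewrite frobenius_tr mulrAC ler_wpM2r ?frobenius_ge0//.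
apply: le_trans (frobeniusM _ _) _; rewrite -mulrA ler_wpM2l ?frobenius_ge0//.
apply: le_trans (frobenius_Dmx_le _) _; rewrite -mulrA ler_wpM2l//.
by apply: row_sum_le => i; exact: row_entry_le_norm.
Qed.

Lemma sympl_eigsP A : posdef A -> is_sympl_eigs A (sympl_eigs A).
Proof.
move=> /posdefE A_pos; have [x Ax] := williamson (tr_symmx A) A_pos.
exact: (@xgetPex _ 0 [set y | is_sympl_eigs A y] (ex_intro _ x Ax)).
Qed.

Lemma Dmx_form_ge x (c : R) (w : 'cV[R]_(n + n)) :
  (forall i, c <= x 0 i) -> c * mxdot w w <= mxdot w (Dmx x *m w).
Proof.
move=> cx; rewrite !mxdotE mulr_sumr ler_sum// => k _.
rewrite !big_ord1 DmxE mul_diag_mx mxE [leRHS]mulrCA ler_wpM2r//.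
  by rewrite -expr2 sqr_ge0.
by case: (split_ordP k) => l ->; rewrite ?row_mxEl ?row_mxEr.
Qed.

Lemma symplectic_congr_form (M B : 'M[R]_(n + n)) (z : 'cV[R]_(n + n)) :
  symplectic M ->
  mxdot z (B *m z) = mxdot (invmx M *m z) (M^T *m B *m M *m (invmx M *m z)).
Proof.
move=> sM; rewrite -!mulmxA mulKVmx ?symplectic_unit// [RHS]mxdot_mulmxr trmxK.
by rewrite mulKVmx ?symplectic_unit.
Qed.

(** In the coordinates [w = M^-1 z], the form of [A] is at least [c |w|^2], and that of [H] is at
    most [|M|^2 |H| |w|^2] in absolute value. *)
Lemma posdef_near A x M : posvec x -> symplectic M -> M^T *m A *m M = Dmx x ->
  exists2 delta, 0 < delta & forall H, `|H| < delta -> posdef (A + H).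
Proof.
move=> x0 sM AM; have [c c_gt0 cx] := posvec_lower_bound x0.
pose f := frobenius M; have f_ge0 : 0 <= f := frobenius_ge0 _.
exists (c / (f ^+ 2 + 1)) => [|H]; first by rewrite divr_gt0// ltr_wpDl ?sqr_ge0.
rewrite ltr_pdivlMr ?ltr_wpDl ?sqr_ge0// -[`|H|]/(frobenius H) => Hc.
apply/posdefE => z z_neq0; rewrite (symplectic_congr_form _ _ sM).
set w := invmx M *m z.
have w_neq0 : w != 0.
  apply: contra_neq z_neq0 => w0.
  by rewrite -(mulKVmx (symplectic_unit sM) z) -/w w0 mulmx0.
have w_gt0 := mxdot_gt0 w_neq0.
rewrite mulmxDr mulmxDl AM mulmxDl mxdotDr.
have h1 := Dmx_form_ge w cx.
have h2 : `|mxdot w (M^T *m H *m M *m w)| <= f ^+ 2 * frobenius H * mxdot w w.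
  apply: le_trans (mxdot_le_frobenius _ _) _.
  rewrite -sqr_frobenius mulrC [frobenius w ^+ 2]expr2 mulrA ler_wpM2r ?frobenius_ge0//.
  apply: le_trans (frobeniusM _ _) _; rewrite ler_wpM2r ?frobenius_ge0//.
  apply: le_trans (frobeniusM _ _) _; rewrite expr2 mulrAC ler_wpM2r ?frobenius_ge0//.
  by apply: le_trans (frobeniusM _ _) _; rewrite frobenius_tr.
have h3 : frobenius H * f ^+ 2 < c by have := frobenius_ge0 H; nra.
move: h2; rewrite ler_norml => /andP[h2 _].
have : 0 < (c - frobenius H * f ^+ 2) * mxdot w w by rewrite mulr_gt0// subr_gt0.
rewrite mulrBl => h4; lra.
Qed.

End SymplecticCongruence.

(** Uniqueness in Williamson's theorem, up to order, is the perturbation estimate at [H = 0], where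
    the distance bound vanishes. *)
Lemma sympl_diag_unique (R : realType) n (x y : 'rV[R]_n.+1) N :
  posvec x -> posvec y -> symplectic N -> N^T *m Dmx x *m N = Dmx y ->
  exists s : 'S_n.+1, forall i, y 0 (s i) = x 0 i.
Proof.
move=> x0 y0 sN xNy.
have g0 i j : x 0 i = x 0 j ->
  (0 : 'rV[R]_n.+1) 0 i = (0 : 'rV[R]_n.+1) 0 j by rewrite !mxE.
have [C [delta [_ delta_gt0 pert]]] := symplectic_perturbation x0 g0.
have [||s [Hs _]] := pert y 0 N _ y0 sN; first by rewrite frobenius0 ltW.
  by rewrite addr0.
exists s => i; have := Hs i.
by rewrite frobenius0 mulr0 normr_le0 subr_eq0 => /eqP.
Qed.

(** * Transfer of differentiability between [f] and [f \o sympl_eigs] *)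

Section MainTheorem.
Context {R : realType} {n : nat}.
Variable f : 'rV[R]_n.+1 -> R.
Hypothesis f_sym : symmetric_fun f.
Variable A : symmx R (n.+1 + n.+1).
Hypothesis A_posdef : posdef A.
Local Notation x := (sympl_eigs A).
Local Notation F := (f \o sympl_eigs).

Let x0 : posvec x. Proof. by have [] := sympl_eigsP A_posdef. Qed.

(** Congruence by [M] reduces to [Dmx x + K] with [K = M^T H M]. By symmetry [f] sees the new
    eigenvalues as [x + h]; the error is the remainder of [f] at [h] plus that of the expansion of
    [mxdot g h], each at most [eps / 2 * |H|]. *)
Lemma comp_sympl_eigs_remainder M : SPup A M -> differentiable f x ->
  forall eps, 0 < eps -> exists2 delta, 0 < delta &
    forall H : symmx R (n.+1 + n.+1),
    `|H| < delta ->
    `|F (A + H) - F A - mxdot (sym_congr M (2^-1 *: grad_vec f x)) H| <= eps * `|H|.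
Proof.
move=> [sM AM] fx eps eps_gt0; set g := grad_vec f x.
have [C [d0 [C_ge0 d0_gt0 pert]]] :=
  symplectic_perturbation x0 (grad_vec_block_constant f_sym x0 fx).
have [d1 d1_gt0 near_pos] := posdef_near x0 sM AM.
have [a a_ge0 aE] : exists2 a, 0 <= a & a = frobenius M ^+ 2.
  by exists (frobenius M ^+ 2); rewrite ?sqr_ge0.
have Ca_ge0 : 0 <= C * a by rewrite mulr_ge0.
have a1_gt0 : 0 < a + 1 by rewrite ltr_wpDl.
have Ca1_gt0 : 0 < C * a + 1 by rewrite ltr_wpDl.
have Ca2_gt0 : 0 < 2 * (C * a ^+ 2 + 1).
  by rewrite mulr_gt0// ltr_wpDl// mulr_ge0// sqr_ge0.
have e1_gt0 : 0 < eps / (2 * (C * a + 1)) by rewrite divr_gt0// mulr_gt0.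
have [d2 d2_gt0 rem] := differentiable_remainder fx e1_gt0.
(* In order, the thresholds ensure that [A + H] is positive definite, that [K] is within [d0], that
   [h] is within [d2], and that the quadratic error is at most [eps / 2 * |H|]. *)
exists (Num.min d1 (Num.min (d0 / (a + 1)) (Num.min (d2 / (C * a + 1))
    (eps / (2 * (C * a ^+ 2 + 1)))))) => [|H].
  by rewrite !lt_min d1_gt0 !divr_gt0.
rewrite !lt_min => /and4P[H1 H2 H3 H4].
have H_ge0 : 0 <= `|H| by [].
rewrite ltr_pdivlMr// in H2.
rewrite ltr_pdivlMr// in H3.
rewrite ltr_pdivlMr// in H4.
have [y0 _ [N sN yN]] := sympl_eigsP (near_pos H H1).
set y := sympl_eigs (A + H) in y0 yN *.
pose K : 'M[R]_(n.+1 + n.+1) := M^T *m H *m M.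
have K_le : frobenius K <= a * `|H|.
  apply: le_trans (frobeniusM _ _) _; rewrite aE expr2 mulrAC ler_wpM2r ?frobenius_ge0//.
  by apply: le_trans (frobeniusM _ _) _; rewrite frobenius_tr.
have Kd0 : frobenius K <= d0 by apply: le_trans K_le _; nra.
have sMN : symplectic (invmx M *m N) by apply: symplecticM => //; apply: symplecticV.
have yMN : (invmx M *m N)^T *m (Dmx x + K) *m (invmx M *m N) = Dmx y.
  have -> : Dmx x + K = M^T *m (A + H : symmx R _) *m M.
    by rewrite /K -AM -mulmxDl -mulmxDr.
  rewrite trmx_mul -!mulmxA mulKVmx ?symplectic_unit// (mulmxA (invmx M)^T) -trmx_mul.
  by rewrite mulmxV ?symplectic_unit// trmx1 mul1mx mulmxA.
have [tau [ytau sumtau]] := pert _ _ _ Kd0 y0 sMN yMN.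
pose h : 'rV[R]_n.+1 := \row_i (y 0 (tau i) - x 0 i).
have h_le : `|h| <= C * a * `|H|.
  apply: row_norm_le => [|i]; first by rewrite mulr_ge0.
  by rewrite mxE; apply: le_trans (ytau i) _; rewrite -mulrA ler_wpM2l.
have h_lt : `|h| < d2 by apply: le_lt_trans h_le _; nra.
have fy : f y = f (x + h).
  apply/esym/(@symmetric_fun_perm _ _ _ _ _ tau) => // i.
  by rewrite !mxE addrC subrK.
have gh : mxdot g h = \sum_i g 0 i * (y 0 (tau i) - x 0 i).
  by rewrite mxdotE big_ord1; apply: eq_bigr => i _; rewrite mxE.
have GH : mxdot (sym_congr M (2^-1 *: g)) H = 2^-1 * \tr (Dmx g *m K).
  rewrite /mxdot tr_symmx /= DmxZ -scalemxAr -!scalemxAl mxtraceZ; congr (_ * _).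
  by rewrite -!mulmxA mxtrace_mulC /K !mulmxA.
have := rem h h_lt; rewrite diff_row_mxdot// -/g gh /= -/y fy GH => h1.
have h1' : eps / (2 * (C * a + 1)) * `|h| <= eps / 2 * `|H|.
  apply: le_trans (_ : eps / (2 * (C * a + 1)) * (C * a * `|H|) <= _).
    by rewrite ler_wpM2l// ltW.
  rewrite mulrA ler_wpM2r// mulrAC ler_pdivrMr ?mulr_gt0//; nra.
have h2 : C * frobenius K ^+ 2 <= eps / 2 * `|H|.
  apply: le_trans (_ : C * (a * `|H|) ^+ 2 <= _).
    by rewrite ler_wpM2l// ler_pXn2r ?nnegrE ?frobenius_ge0// (mulr_ge0 a_ge0 H_ge0).
  rewrite exprMn expr2 [`|H| ^+ 2]expr2 !mulrA ler_wpM2r//.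
  by move: H4; rewrite expr2; lra.
set S := \sum_i _ in h1 sumtau; set T := 2^-1 * _ in sumtau *.
have := le_trans h1 h1'; have := le_trans sumtau h2.
by rewrite !ler_norml => /andP[? ?] /andP[? ?]; apply/andP; split; lra.
Qed.

Lemma differentiable_comp_sympl_eigs M : SPup A M -> differentiable f x ->
  differentiable F A /\
  forall H, 'd F A H = mxdot (sym_congr M (2^-1 *: grad_vec f x)) H.
Proof.
move=> AM fx; pose G := sym_congr M (2^-1 *: grad_vec f x).
have [FA dFA] := differentiable_of_remainder (@mxdot_sym_continuous _ _ G)
  (comp_sympl_eigs_remainder AM fx).
by split => // H; rewrite dFA.
Qed.

(** [M] diagonalises this matrix to [Dmx y] with [y] unordered, so its symplectic eigenvalues are a
    permutation of [y], invisible to the symmetric [f]. *)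
Lemma sympl_eigs_sym_congr M y : symplectic M -> posvec y ->
  f (sympl_eigs (sym_congr (invmx M)^T y)) = f y.
Proof.
move=> sM y0; have M_unit := symplectic_unit sM.
have By : M^T *m sym_congr (invmx M)^T y *m M = Dmx y.
  rewrite /= trmxK !mulmxA -trmx_mul mulVmx// trmx1 mul1mx.
  by rewrite -mulmxA mulVmx// mulmx1.
have B_pos : posdef (sym_congr (invmx M)^T y).
  apply/posdefE => z z_neq0; rewrite (symplectic_congr_form _ _ sM) By.
  have [c c_gt0 cy] := posvec_lower_bound y0.
  apply: lt_le_trans (Dmx_form_ge _ cy); rewrite mulr_gt0// mxdot_gt0//.
  by apply: contra_neq z_neq0 => w0; rewrite -(mulKVmx M_unit z) w0 mulmx0.
have [z0 _ [N sN zN]] := sympl_eigsP B_pos.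
set z := sympl_eigs _ in z0 zN *.
have sMN : symplectic (invmx M *m N) by apply: symplecticM => //; apply: symplecticV.
have zMN : (invmx M *m N)^T *m Dmx y *m (invmx M *m N) = Dmx z.
  by rewrite -zN /= trmx_mul trmxK !mulmxA.
have [s ys] := sympl_diag_unique y0 z0 sMN zMN.
exact/esym/(@symmetric_fun_perm _ _ _ _ _ s).
Qed.

Lemma differentiable_of_comp_sympl_eigs : differentiable F A -> differentiable f x.
Proof.
move=> FA; have [_ _ [M sM AM]] := sympl_eigsP A_posdef.
have M_unit := symplectic_unit sM.
pose L := sym_congr (invmx M)^T.
have Lx : L x = A.
  apply: val_inj; rewrite /= -AM trmxK !mulmxA -trmx_mul mulmxV// trmx1 mul1mx.
  by rewrite -mulmxA mulmxV// mulmx1.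
have FLx : differentiable (F \o L) x.
  apply: differentiable_comp; first exact/linear_differentiable/sym_congr_continuous.
  by rewrite Lx.
have [c c_gt0 cx] := posvec_lower_bound x0.
have FL_f y : posvec y -> (F \o L) y = f y := sympl_eigs_sym_congr sM.
apply: (differentiable_of_remainder (l := 'd (F \o L) x) (diff_continuous FLx) _).1.
move=> eps eps_gt0; have [d d_gt0 Hd] := differentiable_remainder FLx eps_gt0.
(* [f] and [F \o L] agree only on positive vectors; [|h| < c] keeps [x + h] among them. *)
exists (Num.min d c) => [|h]; first by rewrite lt_min d_gt0.
rewrite lt_min => /andP[hd hc]; have := Hd h hd.
rewrite !FL_f// => i; rewrite mxE.
have := row_entry_le_norm h i; have := cx i; rewrite ler_norml => ? /andP[? ?]; lra.
Qed.

(** Any other representing matrix [g] differs from [G] by a symmetric matrix, which may be paired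
    with itself and so vanishes. *)
Lemma grad_sym_comp_sympl_eigs M : SPup A M -> differentiable f x ->
  grad_sym F A = sym_congr M (2^-1 *: grad_vec f x).
Proof.
move=> AM fx; have [_ dF] := differentiable_comp_sympl_eigs AM fx.
set G := sym_congr _ _ in dF *.
rewrite /grad_sym /gradient; case: xgetP => [g _ gP|/(_ G)/(_ dF)//].
apply/eqP; rewrite -subr_eq0; apply/eqP/val_inj/mxdot_eq0.
have E : mxdot (g - G : symmx R _) (g - G : symmx R _) =
    mxdot g (g - G : symmx R _) - mxdot G (g - G : symmx R _).
  by rewrite mxdotDl -scaleN1r mxdotZl mulN1r.
by rewrite E -gP -dF subrr.
Qed.

End MainTheorem.

Theorem theorem3p6 (R : realType) (n : nat) (n_gt0 : (0 < n)%N)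
    (f : 'rV[R]_n -> R) (f_sym : symmetric_fun f)
    (A : symmx R (n + n)) (A_posdef : posdef A) :
  (differentiable (f \o sympl_eigs) A <-> differentiable f (sympl_eigs A)) /\
  (differentiable f (sympl_eigs A) ->
   forall M : 'M[R]_(n + n), SPup A M ->
     (grad_sym (f \o sympl_eigs) A : 'M[R]_(n + n)) =
     2^-1 *: (M *m Dmx (grad_vec f (sympl_eigs A)) *m M^T)).
Proof.
(* Evaluation of polynomials at matrices takes place in a matrix ring of nonzero size, hence the
   successor form of [n]. *)
case: n n_gt0 f f_sym A A_posdef => // {}n _ {}f {}f_sym {}A {}A_posdef.
have [_ _ [M0 sM0 AM0]] := sympl_eigsP A_posdef.
split; first split.
- exact: differentiable_of_comp_sympl_eigs.
- move=> fx.
  by have [] := differentiable_comp_sympl_eigs f_sym A_posdef (conj sM0 AM0) fx.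
move=> fx M AM; rewrite (grad_sym_comp_sympl_eigs f_sym A_posdef AM fx) /=.
by rewrite DmxZ -scalemxAr -scalemxAl.
Qed.
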